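(* Let $\mathcal{H}$ be a real Hilbert space, $A: \mathcal{H} \rightrightarrows \mathcal{H}$ a maximally monotone operator and $D: \mathcal{H} \to \mathcal{H}$ a monotone and $\eta^{-1}$-Lipschitz continuous operator for some $\eta > 0$. Let $m \geq 1$ and, for each $i \in \{1,\ldots,m\}$, let $\mathcal{G}_i$ be a real Hilbert space, $A_i: \mathcal{G}_i \rightrightarrows \mathcal{G}_i$ a maximally monotone operator, $D_i: \mathcal{G}_i \rightrightarrows \mathcal{G}_i$ a maximally monotone operator such that $D_i^{-1}$ is (single-valued and) $\nu_i^{-1}$-Lipschitz continuous for some $\nu_i > 0$, and $L_i: \mathcal{H} \to \mathcal{G}_i$ a nonzero continuous linear operator. Let $B: \mathcal{H} \rightrightarrows \mathcal{H}$ be a maximally monotone operator with $C := \operatorname{zer} B \neq \emptyset$. Consider the primal inclusion problem of finding $x \in \mathcal{H}$ with $$0 \in Ax + \sum_{i=1}^m L_i^* (A_i \Box D_i)(L_i x) + Dx + N_C(x) \qquad (P)$$ and the dual inclusion problem of finding $(v_1,\ldots,v_m) \in \mathcal{G}_1 \times \cdots \times \mathcal{G}_m$ such that $$\exists\, x \in \mathcal{H}: \quad v_i \in (A_i \Box D_i)(L_i x),\ i=1,\ldots,m, \quad \text{and} \quad 0 \in Ax + \sum_{i=1}^m L_i^* v_i + Dx + N_C(x). \qquad (D)$$ Let $(\lambda_n)_{n\in\mathbb{N}}$ and $(\beta_n)_{n\in\mathbb{N}}$ be sequences of positive real numbers. Assume that: (i) $A + N_C$ is maximally monotone and $\operatorname{zer}\left(A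 + \sum_{i=1}^m L_i^* \circ (A_i \Box D_i) \circ L_i + D + N_C\right) \neq \emptyset$; (ii) for every $p \in \operatorname{Ran} N_C$, $\displaystyle\sum_{n\in\mathbb{N}} \lambda_n \beta_n \left(\sup_{\tilde u \in C} \varphi_B\left(\tilde u, \frac{p}{\beta_n}\right) - \sigma_C\left(\frac{p}{\beta_n}\right)\right) < +\infty$; (iii) $(\lambda_n)_{n\in\mathbb{N}} \in \ell^2 \setminus \ell^1$. Let $x_1 \in \mathcal{H}$ and $v_{i,1} \in \mathcal{G}_i$, $i=1,\ldots,m$, be arbitrary, and generate sequences, for all $n \geq 1$, by $$y_{1,n} = x_n - \lambda_n\left(\sum_{i=1}^m L_i^* v_{i,n} + D x_n\right),$$ $$y_{2,i,n} = v_{i,n} - \lambda_n\left(D_i^{-1} v_{i,n} - L_i x_n\right), \quad i=1,\ldots,m,$$ $$p_{1,n} = J_{\lambda_n A}\, y_{1,n},$$ $$p_{2,i,n} = J_{\lambda_n A_i^{-1}}\, y_{2,i,n}, \quad i=1,\ldots,m,$$ $$q_n = p_{1,n} - \lambda_n\left(\sum_{i=1}^m L_i^* p_{2,i,n} + D p_{1,n}\right),$$ $$v_{i,n+1} = v_{i,n} - y_{2,i,n} + p_{2,i,n} - \lambda_n\left(D_i^{-1} p_{2,i,n} - L_i p_{1,n}\right), \quad i=1,\ldots,m,$$ $$x_{n+1} = J_{\lambda_n \beta_n B}(x_n - y_{1,n} + q_n).$$ Define $z_n = \frac{1}{\sum_{k=1}^n \lambda_k}\sum_{k=1}^n \lambda_k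 x_k$ for $n\in\mathbb{N}$. Then $(z_n)_{n\in\mathbb{N}}$ converges weakly to a solution of $(P)$ and $\left(\frac{1}{\sum_{k=1}^n \lambda_k}\sum_{k=1}^n \lambda_k (v_{1,k},\ldots,v_{m,k})\right)_{n\in\mathbb{N}}$ converges weakly to a solution of $(D)$ as $n \to +\infty$. If, additionally, $A$ and $A_i^{-1}$, $i=1,\ldots,m$, are strongly monotone, then $(x_n)_{n\in\mathbb{N}}$ converges strongly to the unique solution of $(P)$ and $(v_{1,n},\ldots,v_{m,n})_{n\in\mathbb{N}}$ converges strongly to the unique solution of $(D)$ as $n \to +\infty$.
   Context: $\mathbb{N} = \{1,2,\ldots\}$. For a set-valued operator $M$ on a real Hilbert space $\mathcal{H}$ (and likewise on $\mathcal{G}_i$): $\operatorname{Graph} M = \{(x,u) : u \in Mx\}$, $\operatorname{Ran} M = \bigcup_{x} Mx$, $\operatorname{zer} M = \{x : 0 \in Mx\}$, and $M^{-1}$ is the operator with $x\in M^{-1}u \iff u\in Mx$. $M$ is monotone if $\langle x-y, u-v\rangle \ge 0$ for all $(x,u),(y,v)\in\operatorname{Graph} M$, and maximally monotone if moreover its graph has no proper monotone extension. $M$ is strongly monotone if there is $\gamma>0$ with $\langle x-y,u-v\rangle\ge\gamma\|x-y\|^2$ for all $(x,u),(y,v)\in\operatorname{Graph} M$. The resolvent is $J_M = (\operatorname{Id}+M)^{-1}$, which is single-valued with full domain when $M$ is maximally monotone. The parallel sum of two operators is $A_i \Box D_i = (A_i^{-1}+D_i^{-1})^{-1}$. $L_i^*$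 denotes the adjoint of $L_i$. The normal cone is $N_C(x)=\{u : \langle u,y-x\rangle\le 0 \text{ for all } y\in C\}$ if $x\in C$ and $N_C(x)=\emptyset$ otherwise; the support function is $\sigma_C(u)=\sup_{y\in C}\langle u,y\rangle$. The Fitzpatrick function of $B$ is $\varphi_B(x,u)=\sup\{\langle x,v\rangle+\langle y,u\rangle-\langle y,v\rangle : (y,v)\in\operatorname{Graph} B\}$, with values in $\mathbb{R}\cup\{\pm\infty\}$. The product $\mathcal{G}_1\times\cdots\times\mathcal{G}_m$ carries the usual Hilbert product structure. *)

(* Defs.v *)
From HB Require Import structures.
From mathcomp Require Import all_boot all_order all_algebra.
From mathcomp Require Import all_classical all_reals all_analysis.

Set Implicit Arguments.
Unset Strict Implicit.
Unset Printing Implicit Defensive.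

Import Order.TTheory GRing.Theory Num.Theory numFieldNormedType.Exports.

Local Open Scope classical_set_scope.
Local Open Scope ring_scope.

Record hilbertType (R : realType) := Hilbert {
  hilbert_sort :> completeNormedModType R;
  inner : {dot hilbert_sort for idfun};
  inner_normE : forall x : hilbert_sort, inner x x = `|x| ^+ 2
}.

Arguments inner {R} h.

Notation "[< x , y >]" := (inner _ x y)
  (at level 0, format "[<  x ,  y  >]") : ring_scope.

(* Set-valued operators V => V are functions V -> set V. *)
Section SetValuedOperators.
Context {R : realType} {V : hilbertType R}.
Implicit Types (M N : V -> set V) (C : set V).

Definition op_graph M : set (V * V) := [set xu | M xu.1 xu.2].

Definition op_ran M : set V := \bigcup_x M x.

Definition op_zer M : set V := [set x | M x 0].

Definition op_inv M : V -> set V := fun u => [set x | M x u].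

Definition op_add M N : V -> set V :=
  fun x => [set u + v | u in M x & v in N x].

Definition op_scale (a : R) M : V -> set V := fun x => [set a *: u | u in M x].

Definition op_fun (f : V -> V) : V -> set V := fun x => [set f x].

Definition par_sum M N : V -> set V := op_inv (op_add (op_inv M) (op_inv N)).

Definition op_monotone M : Prop :=
  forall x u y v, M x u -> M y v -> 0 <= [< x - y, u - v >].

Definition maximally_monotone M : Prop :=
  op_monotone M /\
  forall N, op_monotone N -> op_graph M `<=` op_graph N ->
    op_graph N = op_graph M.

Definition strongly_monotone M : Prop :=
  exists2 gamma : R, 0 < gamma &
    forall x u y v, M x u -> M y v ->
      gamma * `|x - y| ^+ 2 <= [< x - y, u - v >].

(* (Id + M)^-1 is single-valued with full domain when M is maximally monotone;
   the default value 0 is only taken where it is empty-valued. *)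
Definition resolvent M (y : V) : V := xget 0 (op_inv (op_add (op_fun id) M) y).

Definition normal_cone C : V -> set V :=
  fun x => [set u | C x /\ forall y, C y -> [< u, y - x >] <= 0].

Definition support_fun C (u : V) : \bar R :=
  ereal_sup [set ([< u, y >])%:E | y in C].

Definition fitzpatrick M (x u : V) : \bar R :=
  ereal_sup [set ([< x, yv.2 >] + [< yv.1, u >] - [< yv.1, yv.2 >])%:E
            | yv in op_graph M].

End SetValuedOperators.

(* By the Riesz representation theorem the adjoint exists (and is unique) for
   every continuous linear L; 0 is only a default value. *)
Definition adjoint {R : realType} {V W : hilbertType R} (L : V -> W) (y : W) : V :=
  xget 0 [set z : V | forall x : V, [< L x, y >] = [< x, z >]].

Definition prod_inner {R : realType} {m : nat} {G : 'I_m -> hilbertType R}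
    (u v : forall i, G i) : R := \sum_(i < m) [< u i, v i >].

Definition prod_norm {R : realType} {m : nat} {G : 'I_m -> hilbertType R}
    (u : forall i, G i) : R := Num.sqrt (prod_inner u u).

(* Weak convergence in a Hilbert space with carrier T and inner product ip. *)
Definition weak_cvg {R : realType} {T : Type} (ip : T -> T -> R)
    (u : nat -> T) (l : T) : Prop :=
  forall w : T, (fun n => ip (u n) w) @ \oo --> ip l w.

(* Weighted averages of a sequence indexed from 1; the value at n = 0 is junk. *)
Definition ergodic_mean {R : realType} {V : lmodType R} (lambda : nat -> R)
    (x : nat -> V) (n : nat) : V :=
  (\sum_(1 <= k < n.+1) lambda k)^-1 *: \sum_(1 <= k < n.+1) lambda k *: x k.

(* x |-> sum_i L_i^* (A_i [] D_i) (L_i x), as a Minkowski sum. *)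
Definition composite_op {R : realType} {H : hilbertType R} {m : nat}
    {G : 'I_m -> hilbertType R} (Ai Di : forall i, G i -> set (G i))
    (L : forall i, H -> G i) : H -> set H := fun x =>
  [set \sum_(i < m) adjoint (L i) (v i)
  | v in [set v : forall i, G i | forall i, par_sum (Ai i) (Di i) (L i x) (v i)]].

Definition primal_op {R : realType} {H : hilbertType R} {m : nat}
    {G : 'I_m -> hilbertType R} (A : H -> set H) (D : H -> H) (C : set H)
    (Ai Di : forall i, G i -> set (G i)) (L : forall i, H -> G i) : H -> set H :=
  op_add (op_add (op_add A (composite_op Ai Di L)) (op_fun D)) (normal_cone C).

Definition primal_solution {R : realType} {H : hilbertType R} {m : nat}
    {G : 'I_m -> hilbertType R} (A : H -> set H) (D : H -> H) (C : set H)
    (Ai Di : forall i, G i -> set (G i)) (L : forall i, H -> G i) (x : H) : Prop :=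
  primal_op A D C Ai Di L x 0.

Definition dual_solution {R : realType} {H : hilbertType R} {m : nat}
    {G : 'I_m -> hilbertType R} (A : H -> set H) (D : H -> H) (C : set H)
    (Ai Di : forall i, G i -> set (G i)) (L : forall i, H -> G i)
    (v : forall i, G i) : Prop :=
  exists x : H, (forall i, par_sum (Ai i) (Di i) (L i x) (v i)) /\
    op_add (op_add (op_add A (op_fun (fun=> \sum_(i < m) adjoint (L i) (v i))))
                   (op_fun D))
           (normal_cone C) x 0.

(* Main.v *)
Require Import Defs.
From HB Require Import structures.
From mathcomp Require Import all_boot all_order all_algebra.
From mathcomp Require Import all_classical all_reals all_analysis.
From mathcomp Require Import ring lra.

(** Collect the primal variable and the dual variables in one Hilbert space
    K = H x G_1 x ... x G_m. There (P) and (D) together are the inclusion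
    0 \in M u + N u + T u, with M = A x A_1^-1 x ... x A_m^-1,
    N = N_C x 0 x ... x 0 and
    T (x, v) = (sum_i L_i^* v_i + D x, (D_i^-1 v_i - L_i x)_i),
    which is Lipschitz, and monotone because its part coming from the L_i is
    skew. The algorithm, in K, is Tseng's forward-backward-forward step for M
    and T followed by a resolvent of lambda_n beta_n B in the coordinate H.

    Let z_n be the iterates, p_n the intermediate points, a \in M u, c \in N u
    and w = a + c + T u. Expanding squares (tseng_penalty_step) gives
    |z_{n+1} - u|^2 <= |z_n - u|^2 + 2 lambda_n <w, u - z_n>
       - |z_n - p_n|^2 / 2 - 2 lambda_n gamma |p_n - u|^2 + e_n
    where gamma is the modulus of strong monotonicity of M (possibly 0) and e_n
    is a multiple of lambda_n^2 plus twice the n-th term of the series in (ii), which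
    bounds the effect of the resolvent of B by the mere definition of the
    Fitzpatrick function (fitzpatrick_penalty). So e_n is summable.

    For a solution u one can take w = 0, hence |z_n - u| converges. For general
    (u, w), summing the inequality and dividing by sum_k lambda_k shows that a
    weak limit point x of the averages satisfies <w, u - x> >= 0; as M + N is
    maximally monotone and T Lipschitz, x is a solution
    (maximally_monotone_lipschitz_zero). Opial's argument for averages
    (opial_passty) combines both facts into weak convergence. If gamma > 0, the
    inequality at a solution u gives sum_n lambda_n |z_n - u|^2 < oo; since
    sum_n lambda_n = oo and |z_n - u| converges, its limit is 0. This holds for
    every solution u, so the solution is unique.

    The functional analysis behind this rests on a single fact: a convex lower
    semicontinuous function plus |x|^2 / 2 has a minimiser
    (proximal_minimiser). It yields the Riesz representation theorem, hence
    adjoints and weak limits of bounded sequences, and, applied to the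
    Fitzpatrick function, Minty's theorem (minty), hence the resolvents. *)

Import Order.TTheory GRing.Theory Num.Theory numFieldNormedType.Exports.

Local Open Scope classical_set_scope.
Local Open Scope ring_scope.

Set Implicit Arguments.
Unset Strict Implicit.
Unset Printing Implicit Defensive.

(** * Inner products *)

Section DotForm.
Context {R : realType} {U : lmodType R} (f : {dot U for (idfun : R -> R)}).
Implicit Types (x y z : U) (a : R).

Lemma dotC x y : f x y = f y x.
Proof. by rewrite (hermC f x y) expr0 mul1r. Qed.

Lemma dotDl x y z : f (x + y) z = f x z + f y z. Proof. exact: linearDl. Qed.
Lemma dotDr x y z : f z (x + y) = f z x + f z y. Proof. exact: linearDr. Qed.
Lemma dotNl x z : f (- x) z = - f x z. Proof. exact: linearNl. Qed.
Lemma dotNr x z : f z (- x) = - f z x. Proof. exact: linearNr. Qed.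
Lemma dotZl a x z : f (a *: x) z = a * f x z. Proof. exact: linearZl_LR. Qed.
Lemma dotZr a x z : f z (a *: x) = a * f z x. Proof. exact: linearZr_LR. Qed.

Lemma dot0l z : f 0 z = 0. Proof. exact: linear0l. Qed.
Lemma dot0r z : f z 0 = 0. Proof. exact: linear0r. Qed.

Definition dotE := (dotDl, dotDr, dotNl, dotNr, dotZl, dotZr).

Lemma dot_ge0 x : 0 <= f x x.
Proof.
by have [->|/neq0_dnorm_gt0/ltW//] := eqVneq x 0; rewrite dot0r.
Qed.

(** Nonnegativity of the form at f y y *: x - f x y *: y. *)
Lemma dot_cauchy_schwarz x y : f x y ^+ 2 <= f x x * f y y.
Proof.
have [->|y0] := eqVneq y 0; first by rewrite !dot0r expr0n mulr0.
have yy : 0 < f y y by exact: neq0_dnorm_gt0.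
have := dot_ge0 (f y y *: x - f x y *: y).
rewrite !dotE (dotC y x) => h.
suff : 0 <= f y y * (f x x * f y y - f x y ^+ 2).
  by rewrite pmulr_rge0// subr_ge0.
by apply: le_trans h _; rewrite le_eqVlt; apply/orP; left; apply/eqP; ring.
Qed.

End DotForm.

Section InnerProduct.
Context {R : realType} {V : hilbertType R}.
Implicit Types (x y z : V) (a : R).

Lemma ipC x y : [< x, y >] = [< y, x >].
Proof. exact: dotC. Qed.

Definition ipE := @dotE R V (inner V).

Lemma ip0l z : [< 0, z >] = 0.
Proof. exact: dot0l. Qed.

Lemma ip0r z : [< z, 0 >] = 0.
Proof. exact: dot0r. Qed.

Lemma norm_sqr x : `|x| ^+ 2 = [< x, x >].
Proof. by rewrite inner_normE. Qed.

Lemma ip_ge0 x : 0 <= [< x, x >].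
Proof. exact: dot_ge0. Qed.

Lemma ip_le0_eq0 x : [< x, x >] <= 0 -> x = 0.
Proof.
rewrite -norm_sqr => h; apply/eqP; rewrite -normr_eq0 -sqrf_eq0.
by rewrite eq_le h sqr_ge0.
Qed.

Lemma cauchy_schwarz x y : `|[< x, y >]| <= `|x| * `|y|.
Proof.
rewrite -ler_sqr ?nnegrE ?mulr_ge0// exprMn real_normK ?num_real// !norm_sqr.
exact: dot_cauchy_schwarz.
Qed.

Lemma ip_le_norm x y : [< x, y >] <= `|x| * `|y|.
Proof. exact: le_trans (ler_norm _) (cauchy_schwarz x y). Qed.

(** Joint continuity, read off from that of the norm by polarisation. *)
Lemma ip_cvg (I : Type) (F : set_system I) {FF : Filter F} (f g : I -> V) x y :
  f @ F --> x -> g @ F --> y -> [< f i, g i >] @[i --> F] --> [< x, y >].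
Proof.
move=> fx gy.
have polar (u w : V) : [< u, w >] = 2^-1 * (`|u + w| ^+ 2 - `|u| ^+ 2 - `|w| ^+ 2).
  by rewrite !norm_sqr !ipE (ipC w u); field.
rewrite polar; under eq_fun do rewrite polar.
apply: cvgM; first exact: cvg_cst.
have sq (h : I -> V) (z : V) : h @ F --> z -> `|h i| ^+ 2 @[i --> F] --> `|z| ^+ 2.
  by move=> /cvg_norm hz; rewrite expr2; under eq_fun do rewrite expr2; exact: cvgM.
by apply: cvgB; [apply: cvgB|]; apply: sq => //; exact: cvgD.
Qed.

End InnerProduct.

(** * Hilbert sums of finitely many spaces *)

Section ProductHilbert.
Context {R : realType} {I : finType} (G : I -> hilbertType R).

(** Named so that the Euclidean structure below is attached to this type and
    not to every dependent function space. *)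
Definition hprod := forall i, G i.

HB.instance Definition _ := gen_eqMixin hprod.
HB.instance Definition _ := gen_choiceMixin hprod.

Definition hprod_add (x y : hprod) : hprod := fun i => x i + y i.
Definition hprod_opp (x : hprod) : hprod := fun i => - x i.
Definition hprod_zero : hprod := fun i => 0.
Definition hprod_scale (a : R) (x : hprod) : hprod := fun i => a *: x i.

Fact hprod_addA : associative hprod_add.
Proof. by move=> x y z; apply: functional_extensionality_dep => i; exact: addrA. Qed.
Fact hprod_addC : commutative hprod_add.
Proof. by move=> x y; apply: functional_extensionality_dep => i; exact: addrC. Qed.
Fact hprod_add0 : left_id hprod_zero hprod_add.
Proof. by move=> x; apply: functional_extensionality_dep => i; exact: add0r. Qed.
Fact hprod_addN : left_inverse hprod_zero hprod_opp hprod_add.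
Proof. by move=> x; apply: functional_extensionality_dep => i; exact: addNr. Qed.

HB.instance Definition _ := GRing.isZmodule.Build hprod
  hprod_addA hprod_addC hprod_add0 hprod_addN.

Fact hprod_scaleA a b (x : hprod) :
  hprod_scale a (hprod_scale b x) = hprod_scale (a * b) x.
Proof. by apply: functional_extensionality_dep => i; exact: scalerA. Qed.
Fact hprod_scale1 : left_id 1 hprod_scale.
Proof. by move=> x; apply: functional_extensionality_dep => i; exact: scale1r. Qed.
Fact hprod_scaleDr : right_distributive hprod_scale +%R.
Proof. by move=> a x y; apply: functional_extensionality_dep => i; exact: scalerDr. Qed.
Fact hprod_scaleDl (x : hprod) : {morph hprod_scale^~ x : a b / a + b}.
Proof. by move=> a b; apply: functional_extensionality_dep => i; exact: scalerDl. Qed.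

HB.instance Definition _ := GRing.Zmodule_isLmodule.Build R hprod
  hprod_scaleA hprod_scale1 hprod_scaleDr hprod_scaleDl.

Definition hprod_ip (x y : hprod) : R := \sum_i [< x i, y i >].

Fact hprod_ip_bilinear : bilinear_for *%R *%R hprod_ip.
Proof.
split=> [y|x] a u v; rewrite /= /hprod_ip mulr_sumr -big_split /=;
  by apply: eq_bigr => i _; rewrite !ipE.
Qed.

HB.instance Definition _ := bilinear_isBilinear.Build R hprod hprod R
  *%R *%R hprod_ip hprod_ip_bilinear.

Fact hprod_ip_sym (x y : hprod) :
  hprod_ip x y = (-1) ^+ false * idfun (hprod_ip y x).
Proof. by rewrite expr0 mul1r; apply: eq_bigr => i _; rewrite ipC. Qed.

HB.instance Definition _ := isHermitianSesquilinear.Build R hprod false idfun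
  hprod_ip hprod_ip_sym.

Fact hprod_ip_ge0 (x : hprod) : 0 <= hprod_ip x x.
Proof. by apply: sumr_ge0 => i _; exact: ip_ge0. Qed.

Fact hprod_ip_gt0 (x : hprod) : x != 0 -> 0 < hprod_ip x x.
Proof.
move=> x0; rewrite lt_neqAle hprod_ip_ge0 andbT eq_sym.
apply: contraNneq x0 => x0; apply/eqP; apply: functional_extensionality_dep => i.
apply: ip_le0_eq0; have /eqP := x0.
by rewrite psumr_eq0 => [/allP/(_ i)|j _]; rewrite ?ip_ge0// mem_index_enum => /(_ isT)/eqP->.
Qed.

HB.instance Definition _ := isDotProduct.Build R hprod hprod_ip hprod_ip_gt0.

Definition hprod_norm (x : hprod) : R := Num.sqrt (hprod_ip x x).

Fact hprod_norm_sqr (x : hprod) : hprod_norm x ^+ 2 = hprod_ip x x.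
Proof. by rewrite sqr_sqrtr// hprod_ip_ge0. Qed.

Fact hprod_norm_ge0 (x : hprod) : 0 <= hprod_norm x.
Proof. exact: sqrtr_ge0. Qed.

Fact hprod_ip_le (x y : hprod) : hprod_ip x y <= hprod_norm x * hprod_norm y.
Proof.
apply: le_trans (ler_norm _) _.
rewrite -ler_sqr ?nnegrE ?mulr_ge0 ?hprod_norm_ge0// exprMn real_normK ?num_real//.
by rewrite !hprod_norm_sqr; exact: (dot_cauchy_schwarz hprod_ip).
Qed.

Fact hprod_ler_normD (x y : hprod) : hprod_norm (x + y) <= hprod_norm x + hprod_norm y.
Proof.
rewrite -ler_sqr ?nnegrE ?addr_ge0 ?hprod_norm_ge0//.
rewrite hprod_norm_sqr sqrrD !hprod_norm_sqr !(dotE hprod_ip) (dotC hprod_ip y x).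
rewrite /=; have h := hprod_ip_le x y; lra.
Qed.

Fact hprod_normZ (a : R) (x : hprod) : hprod_norm (a *: x) = `|a| * hprod_norm x.
Proof.
rewrite /hprod_norm linearZl_LR linearZr_LR /= mulrA -expr2 sqrtrM ?sqr_ge0//.
by rewrite sqrtr_sqr.
Qed.

Fact hprod_norm0_eq0 (x : hprod) : hprod_norm x = 0 -> x = 0.
Proof.
move=> x0; apply/eqP; apply: contraT => /hprod_ip_gt0.
by rewrite -hprod_norm_sqr x0 expr0n ltxx.
Qed.

HB.instance Definition _ := @Lmodule_isNormed.Build R hprod
  hprod_norm hprod_ler_normD hprod_normZ hprod_norm0_eq0.

Lemma hprod_normE (x : hprod) : `|x| ^+ 2 = \sum_i `|x i| ^+ 2.
Proof.
rewrite [LHS]hprod_norm_sqr.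
by apply: eq_bigr => i _; rewrite norm_sqr.
Qed.

Lemma hprod_proj_le (x : hprod) i : `|x i| <= `|x|.
Proof.
rewrite -ler_sqr ?nnegrE// hprod_normE (bigD1 i)//= lerDl.
by apply: sumr_ge0 => j _; exact: sqr_ge0.
Qed.

(** Together with hprod_proj_le, this compares the Euclidean norm with the norms
    of the components in both directions. *)
Lemma hprod_norm_le_sum (x : hprod) : `|x| <= \sum_i `|x i|.
Proof.
have ge0 (r : seq I) : 0 <= \sum_(i <- r) `|x i| by exact: sumr_ge0.
rewrite -ler_sqr ?nnegrE// hprod_normE.
elim: (index_enum I) => [|i r ih]; first by rewrite !big_nil expr0n.
by rewrite !big_cons sqrrD; have h := mulr_ge0 (normr_ge0 (x i)) (ge0 r); lra.
Qed.

(** The projections of a Cauchy filter are Cauchy filters, and the vector of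
    their limits is its limit by hprod_norm_le_sum. *)
Fact hprod_complete (F : set_system hprod) :
  ProperFilter F -> cauchy F -> cvg F.
Proof.
move=> FF Fc; apply/cvg_ex.
have Fi i : exists l : G i, (fun x : hprod => x i) @ F --> l.
  apply/cvg_ex; apply: cauchy_cvg; apply: cauchy_exP => e e0.
  have [x Fx] := (cauchyP F).1 Fc e e0.
  exists (x i); change (F [set y : hprod | ball (x i) e (y i)]).
  apply: filterS Fx => y; rewrite -!ball_normE /= => yx.
  by apply: le_lt_trans yx; exact: (hprod_proj_le (x - y) i).
exists (fun i => projT1 (cid (Fi i))).
apply/cvgrPdist_lt => e e0.
have n0 : 0 < e / (#|I|.+1)%:R by rewrite divr_gt0.
near=> x.
apply: le_lt_trans (hprod_norm_le_sum _) _.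
apply: (@le_lt_trans _ _ (\sum_(i : I) e / (#|I|.+1)%:R)).
  apply: ler_sum => i _; apply: ltW.
  suff : forall i, `|projT1 (cid (Fi i)) - x i| < e / #|I|.+1%:R by exact.
  near: x; apply: filter_forall => j.
  by have := projT2 (cid (Fi j)) => /cvgrPdist_lt/(_ _ n0).
rewrite sumr_const -[X in X < _]mulr_natr -mulrA gtr_pMr//.
by rewrite mulrC ltr_pdivrMr// mul1r ltr_nat.
Unshelve. all: by end_near. Qed.

HB.instance Definition _ := Uniform_isComplete.Build hprod hprod_complete.

Fact hprod_inner_normE (x : hprod) : hprod_ip x x = `|x| ^+ 2.
Proof. by rewrite [RHS]hprod_norm_sqr. Qed.

Definition hprod_hilbert : hilbertType R := @Hilbert R hprod hprod_ip hprod_inner_normE.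

End ProductHilbert.

(* Simplification would unfold the record and hide that its sum is an inner
   product from the general lemmas. *)
Arguments hprod_hilbert : simpl never.

(** * Minimisation of strongly convex functions and the Riesz theorem *)

Section ProximalMinimisation.
Context {R : realType} {V : hilbertType R}.

(** This is how a minimality along segments becomes a first-order condition: let
    t tend to 0. The proof uses one t, small enough for t * b <= - a / 2. *)
Lemma ge0_of_ge0_scaled (a b : R) :
  (forall t, 0 < t -> t <= 1 -> 0 <= a + t * b) -> 0 <= a.
Proof.
move=> h; rewrite leNgt; apply/negP => a0.
have d0 : 0 < `|b| - a by have := normr_ge0 b; lra.
pose t := - a / (2 * (`|b| - a)).
have t0 : 0 < t by rewrite divr_gt0 ?oppr_gt0// mulr_gt0.
have t1 : t <= 1 by rewrite ler_pdivrMr ?mulr_gt0//; have := normr_ge0 b; lra.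
have := h t t0 t1; have : t * b <= t * (`|b| - a).
  by rewrite ler_wpM2l ?(ltW t0)//; have := ler_norm b; lra.
have -> : t * (`|b| - a) = - a / 2 by rewrite /t; field; lra.
lra.
Qed.

(** P stands for the epigraph of a convex lower semicontinuous function f, which may
    then take the value +oo while all computations stay real. A sequence minimising
    c + |x|^2 / 2 over P is Cauchy by the parallelogram law, and its limit
    (x0, c0) is a minimiser; the conclusion is the first-order condition, that
    - x0 is a subgradient of f at x0. *)
Lemma proximal_minimiser (P : set (V * R)) (b : R) :
  P !=set0 -> closed P ->
  (forall z z' t, P z -> P z' -> 0 <= t -> t <= 1 ->
    P (z.1 + t *: (z'.1 - z.1), z.2 + t * (z'.2 - z.2))) ->
  (forall z, P z -> b <= z.2 + 2^-1 * `|z.1| ^+ 2) ->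
  exists2 z0, P z0 & forall z, P z -> 0 <= z.2 - z0.2 + [< z0.1, z.1 - z0.1 >].
Proof.
move=> [zP Pz] Pcl Pcvx Pb.
pose J (z : V * R) := z.2 + 2^-1 * `|z.1| ^+ 2.
pose E := [set J z | z in P].
have E0 : E !=set0 by exists (J zP), zP.
have Einf : has_inf E by split=> //; exists b => _ [z Pz' <-]; exact: Pb.
have infle z : P z -> inf E <= J z.
  by move=> Pz'; apply: ge_inf; [case: Einf|exists z].
have step n : exists z, P z /\ J z < inf E + (n.+1%:R)^-1.
  have [|_ [z Pz' <-]] := @inf_adherent _ E (n.+1%:R)^-1 _ Einf; first by rewrite invr_gt0.
  by exists z.
pose z n := projT1 (cid (step n)).
have Pzn n : P (z n) by rewrite /z; case: cid => ? [].
have Jzn n : J (z n) < inf E + (n.+1%:R)^-1 by rewrite /z; case: cid => ? [].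
(* The midpoint of two almost minimal points is in P: its value is at least the
   infimum, and it falls below the mean of the two values by |.|^2 / 8. *)
have mid n k : `|(z n).1 - (z k).1| ^+ 2 <= 4 * ((n.+1%:R)^-1 + (k.+1%:R)^-1).
  have h0 : (0 : R) <= 2^-1 by rewrite invr_ge0.
  have h1 : (2^-1 : R) <= 1 by lra.
  have := infle _ (Pcvx _ _ _ (Pzn k) (Pzn n) h0 h1).
  have := Jzn n; have := Jzn k; rewrite /J /= !norm_sqr !ipE (ipC (z n).1 (z k).1).
  move: ((n.+1%:R)^-1) ((k.+1%:R)^-1) (inf E); move=> *; lra.
have zcauchy : cvgn (fun n => (z n).1).
  apply: cauchy_cvg; apply: cauchy_exP => e e0.
  have e8 : 0 < e ^+ 2 / 8 by rewrite divr_gt0// exprn_gt0.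
  have [N _ Ne] := near_infty_natSinv_lt (PosNum e8).
  exists (z N).1; exists N => // n Nn /=.
  rewrite -ball_normE /= -ltr_sqr ?nnegrE ?(ltW e0)//.
  apply: le_lt_trans (mid N n) _.
  have := Ne N (leqnn N); have := Ne n Nn; rewrite /=.
  by move: (n.+1%:R^-1) (N.+1%:R^-1) => r s; lra.
set x0 := limn (fun n => (z n).1) in zcauchy.
have zx : (fun n => (z n).1) @ \oo --> x0 by exact: zcauchy.
have Jlim : J (z n) @[n --> \oo] --> inf E.
  apply: (@squeeze_cvgr _ _ _ _ (fun=> inf E) (fun n => inf E + n.+1%:R^-1)).
  - by apply: nearW => n; rewrite infle// ltW.
  - exact: cvg_cst.
  - by rewrite -[X in _ --> X]addr0; apply: cvgD; [exact: cvg_cst|exact: cvg_harmonic].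
pose c0 := inf E - 2^-1 * `|x0| ^+ 2.
have czlim : (z n).2 @[n --> \oo] --> c0.
  rewrite (_ : (fun n => (z n).2) = (fun n => J (z n) - 2^-1 * [< (z n).1, (z n).1 >])); last first.
    by apply/funext => n; rewrite /J norm_sqr; ring.
  apply: cvgB => //; rewrite norm_sqr; apply: cvgM; [exact: cvg_cst|exact: ip_cvg].
have P0 : P (x0, c0).
  have zlim : z n @[n --> \oo] --> (x0, c0).
    by under eq_fun do rewrite [z _]surjective_pairing; exact: (cvg_pair zx czlim).
  have Pn : \forall n \near \oo, P (z n) by exact: nearW.
  exact: (closed_cvg P Pcl Pn _ zlim).
exists (x0, c0) => // y Py /=.
apply: (@ge0_of_ge0_scaled _ (2^-1 * `|y.1 - x0| ^+ 2)) => t t0 t1.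
rewrite -(pmulr_rge0 _ t0).
have := infle _ (Pcvx _ _ t P0 Py (ltW t0) t1).
rewrite /J /= /c0 !norm_sqr !ipE (ipC y.1 x0) => h.
lra.
Qed.

End ProximalMinimisation.

Section Riesz.
Context {R : realType} {V : hilbertType R}.

(** The first-order condition for the minimiser x0 of f + |x|^2 / 2 is an equality
    since f is linear, so - x0 represents f. *)
Lemma riesz (f : V -> R) (k : R) :
  (forall a x y, f (a *: x + y) = a * f x + f y) ->
  (forall x, `|f x| <= k * `|x|) -> exists z, forall x, f x = [< x, z >].
Proof.
move=> flin fbd.
have f0 : f 0 = 0 by have := flin (-1) 0 0; rewrite scaler0 addr0; lra.
have fZ a x : f (a *: x) = a * f x by rewrite -[a *: x]addr0 flin f0 addr0.
have fD x y : f (x + y) = f x + f y by rewrite -[x in LHS]scale1r flin mul1r.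
have fN x : f (- x) = - f x by rewrite -scaleN1r fZ mulN1r.
have fcont : continuous f.
  move=> x; apply/cvgrPdist_lt => e e0.
  have k1 : 0 < `|k| + 1 by rewrite ltr_wpDl.
  have d0 : 0 < e / (`|k| + 1) by rewrite divr_gt0.
  near=> y.
  have -> : f x - f y = f (x - y) by rewrite fD fN.
  apply: le_lt_trans (fbd _) _.
  apply: (@le_lt_trans _ _ ((`|k| + 1) * `|x - y|)).
    by rewrite ler_wpM2r//; have := ler_norm k; lra.
  by rewrite mulrC -ltr_pdivlMr//; near: y; exact: cvgr_dist_lt.
pose P := [set z : V * R | z.2 = f z.1].
have := @proximal_minimiser R V P (- (2^-1 * k ^+ 2)).
case.
- by exists (0, f 0).
- have -> : P = (fun z : V * R => z.2 - f z.1) @^-1` [set 0].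
    apply/seteqP; split=> z /=; rewrite /P /=; first by move=> ->; rewrite subrr.
    by move/eqP; rewrite subr_eq0 => /eqP.
  apply: closed_comp; last exact: closed_eq.
  move=> z _; apply: cvgB; first exact: cvg_snd.
  exact: continuous_comp (cvg_fst) (fcont _).
- move=> z z' t -> -> _ _; rewrite /P /= fD fZ fD fN; ring.
- move=> z ->; have := fbd z.1; rewrite ler_norml => /andP[h _].
  have := sqr_ge0 (`|z.1| - k); rewrite sqrrB; lra.
move=> [x0 c0] /= P0 h; exists (- x0) => x; have {}P0 : c0 = f x0 := P0.
have hx y : 0 <= f y + [< x0, y >].
  have := h (x0 + y, f (x0 + y)) erefl; rewrite /= P0 fD !ipE; lra.
have := hx x; have := hx (- x); rewrite fN !ipE (ipC x x0); lra.
Unshelve. all: by end_near. Qed.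

End Riesz.

(** * Maximally monotone operators and Minty's theorem *)

Section MaximalMonotone.
Context {R : realType} {V : hilbertType R}.
Implicit Types (M : V -> set V).

(** A pair monotonically related to the graph can be added to it, so maximality
    means that it already belongs to the graph. *)
Lemma maximally_monotoneP M : maximally_monotone M <->
  op_monotone M /\ forall x u,
    (forall y v, M y v -> 0 <= [< x - y, u - v >]) -> M x u.
Proof.
split=> [[Mm Mmax]|[Mm Mrel]]; split=> //.
  move=> x u xu; pose N y := [set v | M y v \/ (y = x /\ v = u)].
  have Nm : op_monotone N.
    move=> y v y' v' [Myv|[-> ->]] [Myv'|[-> ->]].
    - exact: Mm.
    - by have := xu _ _ Myv; rewrite !ipE; lra.
    - exact: xu.
    - by rewrite !subrr ip0r.
  have MN : op_graph M `<=` op_graph N by move=> -[y v] /= Myv; left.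
  have := Mmax N Nm MN; move/seteqP => [h _].
  by apply: (h (x, u)); right.
move=> N Nm MN; apply/seteqP; split=> // -[x u] /= Nxu.
apply: Mrel => y v Myv; apply: Nm => //.
exact: (MN (y, v)).
Qed.

(** Let F be the Fitzpatrick function of M, and P its epigraph on V x V. By
    maximality F (x, u) >= <x, u>, so F (x, u) + (|x|^2 + |u|^2) / 2 is at least
    |x + u|^2 / 2 >= 0 and has a minimiser (x0, u0). Its first-order condition
    at the points of the graph of M says that (- u0, - x0) is monotonically
    related to the graph, hence in it; at that very point it forces
    x0 + u0 = 0. *)
Lemma minty0 M : maximally_monotone M -> exists x, M x (- x).
Proof.
move=> /maximally_monotoneP [Mm Mrel].
pose W := hprod_hilbert (fun _ : bool => V).
have WE (z w : W) : [< z, w >] = [< z true, w true >] + [< z false, w false >].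
  exact: big_bool.
pose pr (x u : V) : W := fun b => if b then x else u.
pose P := [set z : W * R | forall y v, M y v ->
  [< z.1, pr v y >] - [< y, v >] <= z.2].
have graphP y v : M y v -> P (pr y v, [< y, v >]).
  move=> Myv y' v' Myv'; rewrite WE /=.
  have := Mm _ _ _ _ Myv Myv'; rewrite !ipE (ipC v y'); lra.
have [[y0 v0] Myv0] : exists yv : V * V, M yv.1 yv.2.
  apply: contrapT => h; apply: (h); exists (0, 0) => /=; apply: Mrel => y v Myv.
  by case: h; exists (y, v).
have Pge z : P z -> [< z.1 true, z.1 false >] <= z.2.
  move=> Pz; have [Mz|] := pselect (M (z.1 true) (z.1 false)).
    by have := Pz _ _ Mz; rewrite WE /= (ipC (z.1 false)); lra.
  move/(contra_not (@Mrel _ _))/existsNP => [y /existsNP[v /not_implyP[Myv]]].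
  move/negP; rewrite -ltNge => h; have := Pz _ _ Myv.
  move: h; rewrite WE /= !ipE (ipC (z.1 false)); lra.
have := @proximal_minimiser R W P 0.
case.
- by exists (pr y0 v0, [< y0, v0 >]); exact: graphP.
- have -> : P = \bigcap_(yv in op_graph M)
      (fun z : W * R => [< z.1, pr yv.2 yv.1 >] - [< yv.1, yv.2 >] - z.2) @^-1` [set r | r <= 0].
    apply/seteqP; split=> z Pz.
      by move=> [y v] Myv /=; rewrite subr_le0; exact: Pz.
    by move=> y v Myv; have := Pz (y, v) Myv; rewrite /= subr_le0.
  apply: closed_bigI => yv _; apply: closed_comp; last exact: closed_le.
  move=> z _; apply: cvgB; last exact: cvg_snd.
  apply: cvgB; last exact: cvg_cst.
  by apply: ip_cvg; [exact: cvg_fst|exact: cvg_cst].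
- move=> z z' t Pz Pz' t0 t1 y v Myv.
  suff : [< z.1 + t *: (z'.1 - z.1), pr v y >] - [< y, v >] <= z.2 + t * (z'.2 - z.2) by [].
  have := Pz _ _ Myv; have := Pz' _ _ Myv; rewrite !ipE => h' h.
  have t1' : 0 <= 1 - t by rewrite subr_ge0.
  have := ler_wpM2l t0 h'; have := ler_wpM2l t1' h; lra.
- move=> z /Pge h; rewrite norm_sqr WE.
  have := ip_ge0 (z.1 true + z.1 false); rewrite !ipE (ipC (z.1 false)); lra.
move=> [z0 c0] /= P0 h.
set x0 := z0 true; set u0 := z0 false.
have c0ge : [< x0, u0 >] <= c0 by exact: (Pge _ P0).
have key y v : M y v -> [< x0 + u0, x0 + u0 >] <= [< y + u0, v + x0 >].
  move=> Myv; have := h _ (graphP _ _ Myv); rewrite /= WE /=.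
  have -> : (pr y v - z0) true = y - x0 by [].
  have -> : (pr y v - z0) false = v - u0 by [].
  rewrite !ipE (ipC y x0) (ipC u0 x0); lra.
have M0 : M (- u0) (- x0).
  apply: Mrel => y v Myv.
  have := key _ _ Myv; have := ip_ge0 (x0 + u0).
  rewrite !ipE (ipC x0 u0) => *; lra.
have := key _ _ M0; rewrite !addNr ip0l => /ip_le0_eq0/eqP.
by rewrite addr_eq0 => /eqP x0E; exists x0; rewrite {1}x0E.
Qed.

(** Minty's theorem: Id + M is onto. Translating the values of M by y reduces it to
    the value 0. *)
Lemma minty M : maximally_monotone M -> forall y, exists x, M x (y - x).
Proof.
move=> /maximally_monotoneP [Mm Mrel] y.
have [] := @minty0 (fun x => [set u | M x (y + u)]); last by move=> x; exists x.
apply/maximally_monotoneP; split=> [x u x' u'|x u xu] /=.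
  by move=> h h'; have := Mm _ _ _ _ h h'; rewrite !ipE; lra.
apply: Mrel => x' v Mxv; have := xu x' (v - y).
by rewrite /= subrKC => /(_ Mxv); rewrite !ipE; lra.
Qed.

(** The converse of minty. It makes maximality of products a coordinatewise
    matter. *)
Lemma monotone_surj_maximal M : op_monotone M ->
  (forall y, exists x, M x (y - x)) -> maximally_monotone M.
Proof.
move=> Mm Ms; apply/maximally_monotoneP; split=> // x u xu.
have [x' Mx'] := Ms (x + u).
have := xu _ _ Mx'.
have -> : u - (x + u - x') = - (x - x')
  by rewrite !opprB addrCA opprD [- x - u]addrC addNKr.
rewrite dotNr oppr_ge0 => /ip_le0_eq0/eqP; rewrite subr_eq0 => /eqP xx'.
by move: Mx'; rewrite -xx' addrAC subrr add0r.
Qed.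

Lemma maximally_monotone_inv M :
  maximally_monotone M -> maximally_monotone (op_inv M).
Proof.
move=> /maximally_monotoneP [Mm Mrel]; apply/maximally_monotoneP; split.
  by move=> x u y v Mux Mvy; rewrite ipC; exact: Mm.
by move=> x u xu; apply: Mrel => y v Myv; rewrite ipC; exact: xu.
Qed.

Lemma maximally_monotone_scale M (t : R) : 0 < t ->
  maximally_monotone M -> maximally_monotone (op_scale t M).
Proof.
move=> t0 /maximally_monotoneP [Mm Mrel]; apply/maximally_monotoneP; split.
  move=> x _ y _ [u Mxu <-] [v Myv <-].
  by rewrite -scalerBr dotZr pmulr_rge0//; exact: Mm.
move=> x u xu; exists (t^-1 *: u); last by rewrite scalerA divff ?gt_eqF// scale1r.
apply: Mrel => y v Myv; rewrite -(pmulr_rge0 _ t0) -dotZr.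
rewrite scalerBr scalerA divff ?gt_eqF// scale1r; apply: xu.
by exists v.
Qed.

(** By Minty's theorem the resolvent never takes its default value. *)
Lemma resolventP M (t : R) (y : V) : 0 < t -> maximally_monotone M ->
  M (resolvent (op_scale t M) y) (t^-1 *: (y - resolvent (op_scale t M) y)).
Proof.
move=> t0 Mm; rewrite /resolvent; case: xgetP => [x _|none].
  move=> [_ -> [_ [u Mxu <-] <-]].
  by rewrite addrAC subrr add0r scalerA mulVf ?gt_eqF// scale1r.
have [x [u Mxu e]] := minty (maximally_monotone_scale t0 Mm) y.
case: (none x); exists x => //; exists (t *: u); first by exists u.
by rewrite e subrKC.
Qed.

(** A zero of M + T is recognised by the monotonicity inequality alone. Test it at
    the resolvent y of t M at x - t T x: it gives
    |y - x|^2 / t <= <y - x, T y - T x> <= l |y - x|^2,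
    and y = x as soon as 1 / t > l. *)
Lemma maximally_monotone_lipschitz_zero M (T : V -> V) (l : R) (x : V) :
  maximally_monotone M -> (forall y z, `|T y - T z| <= l * `|y - z|) ->
  (forall y u, M y u -> 0 <= [< y - x, u + T y >]) -> M x (- T x).
Proof.
move=> Mm Tl h.
have l0 : 0 < `|l| + 1 by rewrite ltr_wpDl.
set t := (`|l| + 1)^-1; have t0 : 0 < t by rewrite invr_gt0.
set y := resolvent (op_scale t M) (x - t *: T x).
have My := resolventP (x - t *: T x) t0 Mm; rewrite -/y in My.
have := h _ _ My; rewrite {2}/t invrK.
set s := `|l| + 1.
have -> : s *: (x - t *: T x - y) = - (s *: (y - x)) - T x.
  rewrite !scalerBr scalerA [s * t]divff ?gt_eqF// scale1r.
  by rewrite opprB addrAC.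
rewrite -addrA dotDr dotNr dotZr [- T x + _]addrC => h1.
have : [< y - x, T y - T x >] <= `|l| * `|y - x| ^+ 2.
  apply: le_trans (ip_le_norm _ _) _; rewrite mulrC expr2 mulrA ler_wpM2r//.
  by apply: le_trans (Tl _ _) _; rewrite ler_wpM2r// ler_norm.
rewrite norm_sqr => h2.
have /ip_le0_eq0/eqP : [< y - x, y - x >] <= 0 by rewrite /s in h1; lra.
rewrite subr_eq0 => /eqP yx; rewrite yx in My.
by move: My; rewrite addrAC subrr add0r scalerN scalerA mulVf ?gt_eqF// scale1r.
Qed.

End MaximalMonotone.

Section ProductOperator.
Context {R : realType} {I : finType} (G : I -> hilbertType R).

Definition op_prod (M : forall i, G i -> set (G i)) :
    hprod_hilbert G -> set (hprod_hilbert G) :=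
  fun x => [set u | forall i, M i (x i) (u i)].

Lemma maximally_monotone_prod (M : forall i, G i -> set (G i)) :
  (forall i, maximally_monotone (M i)) -> maximally_monotone (op_prod M).
Proof.
move=> Mm; apply: monotone_surj_maximal => [x u y v xu yv|y].
  by apply: sumr_ge0 => i _; have /maximally_monotoneP[h _] := Mm i; exact: h.
have h i : exists x, M i x (y i - x) by exact: minty.
by exists (fun i => projT1 (cid (h i))) => i; exact: (projT2 (cid (h i))).
Qed.

Lemma strongly_monotone_prod (M : forall i, G i -> set (G i)) :
  (forall i, strongly_monotone (M i)) -> strongly_monotone (op_prod M).
Proof.
move=> Ms; have h i : exists g, 0 < g /\ forall x u y v, M i x u -> M i y v ->
    g * `|x - y| ^+ 2 <= [< x - y, u - v >].
  by have [g g0 gP] := Ms i; exists g.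
pose g i := projT1 (cid (h i)).
have g0 i : 0 < g i by rewrite /g; case: cid => ? [].
have gP i x u y v : M i x u -> M i y v ->
    g i * `|x - y| ^+ 2 <= [< x - y, u - v >].
  by rewrite /g; case: cid => r /= [_ rP]; exact: rP.
have Vg0 : 0 < 1 + \sum_i (g i)^-1.
  by rewrite ltr_pwDl// sumr_ge0// => i _; rewrite invr_ge0 ltW.
(* The inverse of a sum of inverses is a positive lower bound of all moduli. *)
exists (1 + \sum_i (g i)^-1)^-1; first by rewrite invr_gt0.
move=> x u y v xu yv; rewrite hprod_normE mulr_sumr.
apply: ler_sum => i _; apply: le_trans (gP _ _ _ _ _ (xu i) (yv i)).
rewrite ler_wpM2r ?sqr_ge0// -[leRHS]invrK lef_pV2 ?posrE ?invr_gt0//.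
rewrite (bigD1 i)//= addrCA lerDl addr_ge0// sumr_ge0// => j _.
by rewrite invr_ge0 ltW.
Qed.

End ProductOperator.

(** * Summable perturbations and weighted averages *)

Section RealSequences.
Context {R : realType}.
Implicit Types (a e lam : nat -> R).

(** Summability, for sequences of nonnegative terms. *)
Definition bounded_sums e := exists S : R, forall n, \sum_(0 <= k < n) e k <= S.

Lemma sum_nat_le_mono e n k : (forall i, 0 <= e i) -> (n <= k)%N ->
  \sum_(0 <= i < n) e i <= \sum_(0 <= i < k) e i.
Proof.
move=> e0 nk; rewrite [leRHS](@big_cat_nat _ _ _ n)//= lerDl.
exact: sumr_ge0.
Qed.

Lemma sum_head_le e (N n : nat) : (forall k, 0 <= e k) ->
  \sum_(0 <= k < n) (if (k < N)%N then e k else 0) <= \sum_(0 <= k < N) e k.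
Proof.
move=> e0.
rewrite [leRHS](big_nat_widen 0 N (maxn n N))//= ?leq_maxr// [leRHS]big_mkcond /=.
by apply: sum_nat_le_mono (leq_maxl _ _) => i; case: ifP.
Qed.

(** Finitely many exceptions to a summable bound are absorbed by enlarging it. So
    an estimate that needs small steps may be used from the first index on. *)
Lemma bounded_sums_dominate a e : (forall n, 0 <= e n) -> bounded_sums e ->
  (\forall n \near \oo, a n <= e n) ->
  exists e' : nat -> R,
    [/\ forall n, 0 <= e' n, bounded_sums e' & forall n, a n <= e' n].
Proof.
move=> e0 [S eS] [N _ aN].
pose h k := if (k < N)%N then `|a k| else 0.
have h0 k : 0 <= h k by rewrite /h; case: ifP.
exists (fun k => h k + e k); split.
- by move=> n; rewrite addr_ge0.
- exists (\sum_(0 <= k < N) `|a k| + S) => n.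
  by rewrite big_split /= lerD// sum_head_le.
move=> n; rewrite /h; case: ltnP => nN.
  by rewrite (le_trans (ler_norm _))// lerDl.
by rewrite add0r; exact: aN.
Qed.

Lemma bounded_sums_cvg e : (forall n, 0 <= e n) -> bounded_sums e ->
  cvgn (fun n => \sum_(0 <= k < n) e k).
Proof.
move=> e0 [S eS]; apply: nondecreasing_is_cvgn.
  by move=> n k nk; exact: sum_nat_le_mono.
by exists S => _ [n _ <-].
Qed.

Lemma bounded_sums_cvg0 e : (forall n, 0 <= e n) -> bounded_sums e ->
  e @ \oo --> (0 : R).
Proof. by move=> e0 eS; apply: cvg_series_cvg_0; exact: bounded_sums_cvg. Qed.

(** Subtracting the partial sums of e makes the sequence nonincreasing. *)
Lemma quasi_fejer_cvg a e : (forall n, 0 <= a n) -> (forall n, 0 <= e n) ->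
  bounded_sums e -> (forall n, a n.+1 <= a n + e n) -> cvgn a.
Proof.
move=> a0 e0 eS ae.
have Ecvg := bounded_sums_cvg e0 eS.
pose b n := a n - \sum_(0 <= k < n) e k.
have bcvg : cvgn b.
  apply: nonincreasing_is_cvgn.
    apply/nonincreasing_seqP => n; rewrite /b big_nat_recr//=.
    by have := ae n; lra.
  case: eS => S eS; exists (- S) => _ [n _ <-].
  by rewrite /b; have := a0 n; have := eS n; lra.
have -> : a = b \+ (fun n => \sum_(0 <= k < n) e k).
  by apply/funext => n; rewrite /b /= subrK.
exact: is_cvgD.
Qed.

Lemma telescope_bound (D g e : nat -> R) : (forall n, 0 <= D n) ->
  bounded_sums e -> (forall n, D n.+1 - D n + g n <= e n) -> bounded_sums g.
Proof.
move=> D0 [S eS] ineq; exists (D 0 + S) => n.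
suff : D n + \sum_(0 <= k < n) g k <= D 0 + \sum_(0 <= k < n) e k.
  by have := eS n; have := D0 n; lra.
elim: n => [|n ih]; first by rewrite !big_nil !addr0.
by rewrite !big_nat_recr//=; have := ineq n; lra.
Qed.

(** Finitely many terms are far from l, and their share of the diverging total
    weight vanishes. *)
Lemma weighted_cesaro lam a (l : R) : (forall n, 0 < lam n) ->
  \sum_(0 <= k < n) lam k @[n --> \oo] --> +oo -> a @ \oo --> l ->
  (\sum_(0 <= k < n) lam k)^-1 * \sum_(0 <= k < n) lam k * a k @[n --> \oo] --> l.
Proof.
move=> lam0 lamoo al; apply/cvgrPdist_le => eps eps0.
have eps2 : 0 < eps / 2 by rewrite divr_gt0.
have /cvgrPdist_le/(_ _ eps2)[N _ aN] := al.
set C := \sum_(0 <= k < N) lam k * `|l - a k|.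
have C0 : 0 <= C by apply: sumr_ge0 => k _; rewrite mulr_ge0// ltW.
near=> n.
have Lam_gt : C / (eps / 2) + 1 <= \sum_(0 <= k < n) lam k.
  by near: n; move/cvgryPge : lamoo; exact.
set Lam := \sum_(0 <= k < n) lam k in Lam_gt *.
have Lam0 : 0 < Lam by apply: lt_le_trans Lam_gt; rewrite ltr_wpDl// divr_ge0// ltW.
have -> : l - Lam^-1 * \sum_(0 <= k < n) lam k * a k =
    Lam^-1 * \sum_(0 <= k < n) lam k * (l - a k).
  under [in RHS]eq_bigr do rewrite mulrBr.
  rewrite sumrB -mulr_suml -/Lam mulrBr; congr (_ - _).
  by rewrite mulrA mulVf ?mul1r// gt_eqF.
rewrite normrM gtr0_norm ?invr_gt0// mulrC ler_pdivrMr//.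
apply: le_trans (ler_norm_sum _ _ _) _.
apply: (@le_trans _ _ (\sum_(0 <= k < n)
    ((if (k < N)%N then lam k * `|l - a k| else 0) + eps / 2 * lam k))).
  apply: ler_sum => k _; rewrite normrM gtr0_norm//.
  case: ltnP => kN; first by rewrite lerDl mulr_ge0// ltW.
  by rewrite add0r mulrC ler_wpM2r ?(ltW (lam0 k))//; exact: aN.
rewrite big_split /= -mulr_sumr -/Lam.
have : C <= eps / 2 * Lam.
  rewrite mulrC -ler_pdivrMr//; apply: le_trans Lam_gt; lra.
have := @sum_head_le (fun k => lam k * `|l - a k|) N n _.
move=> /(_ (fun k => mulr_ge0 (ltW (lam0 k)) (normr_ge0 _))); rewrite -/C.
by move=> *; lra.
Unshelve. all: by end_near. Qed.

End RealSequences.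

Section WeightedMean.
Context {R : realType} {V : hilbertType R}.

Definition weighted_mean (lam : nat -> R) (z : nat -> V) (n : nat) : V :=
  (\sum_(0 <= k < n) lam k)^-1 *: \sum_(0 <= k < n) lam k *: z k.

Lemma ip_suml (I : Type) (r : seq I) (F : I -> V) (w : V) :
  [< \sum_(i <- r) F i, w >] = \sum_(i <- r) [< F i, w >].
Proof.
by elim/big_rec2: _ => [|i a b _ <-]; rewrite ?ip0l ?dotDl.
Qed.

Lemma ip_weighted_mean lam z n w : [< weighted_mean lam z n, w >] =
  (\sum_(0 <= k < n) lam k)^-1 * \sum_(0 <= k < n) lam k * [< z k, w >].
Proof.
rewrite /weighted_mean dotZl ip_suml; congr (_ * _).
by apply: eq_bigr => k _; rewrite dotZl.
Qed.

Lemma weighted_mean_bounded lam z (r : R) : (forall n, 0 < lam n) ->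
  (forall n, `|z n| <= r) -> forall n, `|weighted_mean lam z n| <= r.
Proof.
move=> lam0 zr [|n]; rewrite /weighted_mean.
  by rewrite !big_nil scaler0 normr0 (le_trans _ (zr 0)).
have Lam0 : 0 < \sum_(0 <= k < n.+1) lam k.
  by rewrite big_nat_recr//= ltr_wpDl// sumr_ge0// => k _; exact: ltW.
rewrite normrZ gtr0_norm ?invr_gt0// mulrC ler_pdivrMr// mulrC mulr_suml.
apply: le_trans (ler_norm_sum _ _ _) _; apply: ler_sum => k _.
by rewrite normrZ gtr0_norm// ler_wpM2l// ltW.
Qed.

End WeightedMean.

(** * Weak limits along ultrafilters and the Opial-Passty lemma *)

Section WeakLimits.
Context {R : realType} {V : hilbertType R}.

Lemma ultra_cvg_bounded (T : Type) (U : set_system T) (f : T -> R) (r : R) :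
  UltraFilter U -> (forall i, `|f i| <= r) -> exists l : R, f @ U --> l.
Proof.
move=> UU fr.
have [|l [_ lcl]] := @segment_compact R (- r) r (f @ U) _.
  by apply: (@filterE _ U) => i; rewrite /= in_itv /= -ler_norml.
exists l => B Bl; case: (@in_ultra_setVsetC _ U (f @^-1` B) UU) => // UnB.
by have [y []] := lcl (~` B) B UnB Bl.
Qed.

(** Weak compactness of balls. Along an ultrafilter every bounded scalar family
    converges, and the limit of <z i, w> is a bounded linear function of w,
    which the Riesz theorem represents by a vector. *)
Lemma ultra_weak_limit (T : Type) (U : set_system T) (z : T -> V) (r : R) :
  UltraFilter U -> (forall i, `|z i| <= r) ->
  exists l, forall w, [< z i, w >] @[i --> U] --> [< l, w >].
Proof.
move=> UU zr.
have ex w : exists l : R, [< z i, w >] @[i --> U] --> l.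
  apply: (@ultra_cvg_bounded _ _ _ (r * `|w|)) => i.
  by rewrite (le_trans (cauchy_schwarz _ _))// ler_wpM2r.
pose f w := projT1 (cid (ex w)).
have fP w : [< z i, w >] @[i --> U] --> f w by exact: (projT2 (cid (ex w))).
have [|w|l fl] := @riesz R V f r.
- move=> a x y.
  suff h : [< z i, a *: x + y >] @[i --> U] --> a * f x + f y.
    exact: (cvg_unique _ (fP _) h).
  have -> : (fun i => [< z i, a *: x + y >]) =
      (fun i => a * [< z i, x >] + [< z i, y >]).
    by apply/funext => i; rewrite dotDr dotZr.
  by apply: cvgD => //; apply: cvgM => //; exact: cvg_cst.
- apply: (@closed_cvg _ _ U _ (fun i => [< z i, w >]) [set s | `|s| <= r * `|w|]) (fP w).
    exact: closed_comp (fun _ _ => @norm_continuous _ _ _) (@closed_le _ _).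
  by apply: nearW => i /=; rewrite (le_trans (cauchy_schwarz _ _))// ler_wpM2r.
exists l => w; rewrite ipC -fl; exact: fP.
Qed.

(** If f stayed away from l infinitely often, those indices would belong to some
    ultrafilter finer than the filter at infinity. *)
Lemma cvg_ultraP (f : nat -> R) (l : R) :
  (forall U, UltraFilter U -> \oo `<=` U -> f @ U --> l) -> f @ \oo --> l.
Proof.
move=> h; apply: contrapT => nfl.
have [B Bl nB] : exists2 B, nbhs l B & ~ (\oo (f @^-1` B)).
  apply: contrapT => h'; apply: nfl => B Bl; apply: contrapT => nB.
  by apply: h'; exists B.
have GF : ProperFilter (within (~` (f @^-1` B)) \oo).
  apply: Build_ProperFilter => // h0; apply: nB.
  by move: h0; rewrite /within /=; apply: filterS => n /= hn; exact: contrapT.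
have [U [UU GU]] := ultraFilterLemma GF.
have ooU : \oo `<=` U.
  by move=> A Aoo; apply: GU; rewrite /within /=; apply: filterS Aoo => n An _.
have UB : U (f @^-1` B) := h U UU ooU B Bl.
have UnB : U (~` (f @^-1` B)) by apply: GU; rewrite /within /=; exact: nearW.
by have [n []] := filter_ex (filterI UB UnB).
Qed.

(** Let l0 and l be weak limits of the averages along two ultrafilters. Both are
    in F, so <z_n, l0 - l> converges by polarisation, and so do its averages.
    Hence <l0, l0 - l> = <l, l0 - l>, that is l0 = l: the weak limit does not
    depend on the ultrafilter. *)
Lemma opial_passty (F : set V) (lam : nat -> R) (z : nat -> V) :
  (forall n, 0 < lam n) ->
  \sum_(0 <= k < n) lam k @[n --> \oo] --> +oo ->
  F !=set0 ->
  (forall u, F u -> cvgn (fun n => `|z n - u| ^+ 2)) ->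
  (forall U l, UltraFilter U -> \oo `<=` U ->
    (forall w, [< weighted_mean lam z n, w >] @[n --> U] --> [< l, w >]) -> F l) ->
  exists2 l, F l & weak_cvg (inner V) (weighted_mean lam z) l.
Proof.
move=> lam0 lamoo [u0 Fu0] Fcvg Fcl.
have [r zr] : exists r, forall n, `|z n| <= r.
  have [M [_ hM]] := cvg_seq_bounded (Fcvg _ Fu0).
  have {}hM n : `|z n - u0| ^+ 2 <= `|M| + 1.
    have M1 : M < `|M| + 1 by have := ler_norm M; lra.
    by have := hM _ M1 n I; rewrite /= ger0_norm ?sqr_ge0.
  exists (`|M| + 1 + 1 + `|u0|) => n.
  have : `|z n| <= `|z n - u0| + `|u0| by rewrite -{1}[z n](subrK u0) ler_normD.
  by have := hM n; have := sqr_ge0 (`|z n - u0| - 1); rewrite sqrrB; have := normr_ge0 M; lra.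
have lim U : UltraFilter U -> exists l, forall w,
    [< weighted_mean lam z n, w >] @[n --> U] --> [< l, w >].
  by move=> UU; apply: ultra_weak_limit => n; exact: weighted_mean_bounded.
have [U0 [UU0 ooU0]] := @ultraFilterLemma _ \oo _.
have [l0 l0P] := lim _ UU0; have Fl0 : F l0 := Fcl _ _ UU0 ooU0 l0P.
exists l0 => // w; apply: cvg_ultraP => U UU ooU.
have [l lP] := lim _ UU; have Fl : F l := Fcl _ _ UU ooU lP.
suff -> : l0 = l by exact: lP.
have [c cP] : exists c : R, [< weighted_mean lam z n, l0 - l >] @[n --> \oo] --> c.
  have /cvg_ex[a aP] := Fcvg _ Fl; have /cvg_ex[a0 a0P] := Fcvg _ Fl0.
  pose c := 2^-1 * (a - a0 + (`|l0| ^+ 2 - `|l| ^+ 2)).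
  have cP : [< z n, l0 - l >] @[n --> \oo] --> c.
    have -> : (fun n => [< z n, l0 - l >]) = (fun n =>
        2^-1 * (`|z n - l| ^+ 2 - `|z n - l0| ^+ 2 + (`|l0| ^+ 2 - `|l| ^+ 2))).
      apply/funext => n; rewrite !norm_sqr !ipE (ipC l (z n)) (ipC l0 (z n)); lra.
    apply: cvgM; first exact: cvg_cst.
    by apply: cvgD; [exact: cvgB|exact: cvg_cst].
  exists c; under eq_fun do rewrite ip_weighted_mean.
  exact: weighted_cesaro.
have e0 : [< l0, l0 - l >] = c.
  by apply: (cvg_unique _ (l0P _)) => //; exact: cvg_trans (cvg_app _ ooU0) cP.
have e : [< l, l0 - l >] = c.
  by apply: (cvg_unique _ (lP _)) => //; exact: cvg_trans (cvg_app _ ooU) cP.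
apply/eqP; rewrite -subr_eq0; apply/eqP; apply: ip_le0_eq0.
by rewrite dotDl dotNl e0 e subrr.
Qed.

End WeakLimits.

(** * Tseng's method with a penalty step *)

Section TsengStep.
Context {R : realType} {K : hilbertType R}.

(** One iteration leads from z to z' through p. Here d stands for T z - T p, and
    the two last hypotheses are the inequalities for the points p and z' that come
    from the monotonicity of M and T and from the penalty term; w and c are
    elements of (M + N + T) u and N u. After expansion of the squares, three
    Young inequalities absorb the cross terms at the price of multiples of
    lam ^+ 2, and the smallness of lam * l leaves half of |z - p|^2. *)
Lemma tseng_penalty_step (z p z' u d w c : K) (lam l gam delta : R) :
  0 <= lam -> lam ^+ 2 * l ^+ 2 <= 8^-1 -> `|d| <= l * `|z - p| ->
  lam * (gam * `|p - u| ^+ 2 + [< w - c, p - u >]) <=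
    [< z - p - lam *: d, p - u >] ->
  [< p + lam *: d - z', u - z' >] <= delta + lam * [< c, u - z' >] ->
  `|z' - u| ^+ 2 - `|z - u| ^+ 2 - 2 * lam * [< w, u - z >]
    + 2^-1 * `|z - p| ^+ 2 + 2 * lam * gam * `|p - u| ^+ 2
  <= 2 * delta + lam ^+ 2 * (4 * `|w| ^+ 2 + 2 * `|c| ^+ 2).
Proof.
move=> lam0 laml dl forward backward.
have d2 : lam ^+ 2 * `|d| ^+ 2 <= 8^-1 * `|z - p| ^+ 2.
  apply: (@le_trans _ _ (lam ^+ 2 * (l * `|z - p|) ^+ 2)).
    by rewrite ler_wpM2l ?sqr_ge0// ler_sqr ?nnegrE// (le_trans _ dl).
  by rewrite exprMn mulrA ler_wpM2r ?sqr_ge0.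
have young1 := ip_ge0 (p + lam *: d - z' - lam *: c).
have young2 := mulr_ge0 (sqr_ge0 lam) (ip_ge0 (c + d)).
have young3 := ip_ge0 (2^-1 *: (z - p) - (2 * lam) *: w).
move: forward backward d2 young1 young2 young3; rewrite !norm_sqr !ipE.
rewrite ?(ipC p z) ?(ipC z' z) ?(ipC u z) ?(ipC d z) ?(ipC w z) ?(ipC c z).
rewrite ?(ipC z' p) ?(ipC u p) ?(ipC d p) ?(ipC w p) ?(ipC c p).
rewrite ?(ipC u z') ?(ipC d z') ?(ipC w z') ?(ipC c z').
rewrite ?(ipC d u) ?(ipC w u) ?(ipC c u) ?(ipC w d) ?(ipC c d).
lra.
Qed.

End TsengStep.

Section TsengPenalty.
Context {R : realType} {K : hilbertType R}.
Variables (M N : K -> set K) (T : K -> K) (l gam : R).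
(* The value gam = 0 covers operators M that are just monotone. *)
Hypothesis gam0 : 0 <= gam.
Hypothesis Mmono : forall x a y b, M x a -> M y b ->
  gam * `|x - y| ^+ 2 <= [< x - y, a - b >].
Hypothesis MNmax : maximally_monotone (op_add M N).
Hypothesis Tmono : forall x y, 0 <= [< x - y, T x - T y >].
Hypothesis Tlip : forall x y, `|T x - T y| <= l * `|x - y|.
Variables (lam : nat -> R) (z p : nat -> K).
Hypothesis lam_gt0 : forall n, 0 < lam n.
Hypothesis lam_l2 : bounded_sums (fun n => lam n ^+ 2).
Hypothesis lam_l1 : \sum_(0 <= k < n) lam k @[n --> \oo] --> +oo.
Hypothesis forward : forall n,
  M (p n) ((lam n)^-1 *: (z n - lam n *: T (z n) - p n)).
(* The last step of the iteration enters through this inequality only. For a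
   resolvent of lambda_n beta_n B it is an instance of the definition of the
   Fitzpatrick function of B. *)
Hypothesis backward : forall u c, N u c -> exists delta : nat -> R,
  [/\ forall n, 0 <= delta n, bounded_sums delta & forall n,
    [< p n + lam n *: (T (z n) - T (p n)) - z n.+1, u - z n.+1 >] <=
      delta n + lam n * [< c, u - z n.+1 >]].

Let lam0 n : 0 <= lam n := ltW (lam_gt0 n).

Lemma step_sqr_cvg0 : lam n ^+ 2 @[n --> \oo] --> (0 : R).
Proof. by apply: bounded_sums_cvg0 => // n; exact: sqr_ge0. Qed.

(** The errors of tseng_penalty_step are summable. Its condition on the step size
    holds from some index on, because lam tends to 0. *)
Lemma tseng_penalty_fejer u a c : M u a -> N u c -> exists e : nat -> R,
  [/\ forall n, 0 <= e n, bounded_sums e & forall n,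
    `|z n.+1 - u| ^+ 2 - `|z n - u| ^+ 2 - 2 * lam n * [< a + c + T u, u - z n >]
    + 2^-1 * `|z n - p n| ^+ 2 + 2 * lam n * gam * `|p n - u| ^+ 2 <= e n].
Proof.
move=> Mua Nuc; have [delta [delta0 [S dS] back]] := backward Nuc.
set w := a + c + T u.
set B := 4 * `|w| ^+ 2 + 2 * `|c| ^+ 2.
have B0 : 0 <= B by rewrite addr_ge0// mulr_ge0// sqr_ge0.
apply: (@bounded_sums_dominate _ _ (fun n => 2 * delta n + lam n ^+ 2 * B)).
- by move=> n; rewrite addr_ge0 ?mulr_ge0 ?sqr_ge0.
- have [S2 lS2] := lam_l2; exists (2 * S + S2 * B) => n.
  by rewrite big_split /= -mulr_sumr -mulr_suml lerD ?ler_wpM2l ?ler_wpM2r.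
have l1 : 0 < l ^+ 2 + 1 by rewrite ltr_wpDl ?sqr_ge0.
have t0 : 0 < 8^-1 / (l ^+ 2 + 1) by rewrite divr_gt0.
near=> n.
apply: (@tseng_penalty_step _ _ _ _ _ _ (T (z n) - T (p n)) _ c _ l) => //.
- have : lam n ^+ 2 <= 8^-1 / (l ^+ 2 + 1).
    near: n; have /cvgrPdist_le/(_ _ t0) := step_sqr_cvg0.
    by apply: filterS => n; rewrite sub0r normrN ger0_norm ?sqr_ge0.
  rewrite ler_pdivlMr//; have := sqr_ge0 (lam n); lra.
- have := Mmono (forward n) Mua; rewrite -(ler_pM2l (lam_gt0 n)).
  have := mulr_ge0 (lam0 n) (Tmono (p n) u).
  set m := _^-1 *: _.
  have -> : z n - p n - lam n *: (T (z n) - T (p n)) =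
      lam n *: m + lam n *: T (p n).
    rewrite /m scalerA divff ?gt_eqF// scale1r scalerBr opprB addrA.
    by rewrite [LHS]addrAC [RHS]addrC [z n - _ - _]addrAC addrC.
  rewrite /w !ipE; rewrite !(ipC (p n)) !(ipC u); lra.
Unshelve. all: by end_near. Qed.

Lemma tseng_penalty_dist_cvg u : op_add M N u (- T u) ->
  cvgn (fun n => `|z n - u| ^+ 2).
Proof.
move=> [a Mua [c Nuc ac]]; have [e [e0 eS ineq]] := tseng_penalty_fejer Mua Nuc.
apply: (quasi_fejer_cvg _ e0 eS) => n; first exact: sqr_ge0.
have := ineq n; rewrite ac addNr ip0l.
have := mulr_ge0 (mulr_ge0 (lam0 n) gam0) (sqr_ge0 `|p n - u|).
have := sqr_ge0 `|z n - p n|; lra.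
Qed.

Lemma sum_steps_gt0 n : 0 < \sum_(0 <= k < n.+1) lam k.
Proof. by rewrite big_nat_recr//= ltr_wpDl// sumr_ge0. Qed.

Lemma sum_stepsV_cvg0 (C : R) :
  C * (\sum_(0 <= k < n) lam k)^-1 @[n --> \oo] --> (0 : R).
Proof.
rewrite -[X in _ --> X](mulr0 C); apply: cvgM; first exact: cvg_cst.
apply/gtr0_cvgV0 => //; exists 1 => // -[|n] _//; exact: sum_steps_gt0.
Qed.

(** Summing the inequality of tseng_penalty_fejer bounds the average of
    <w, z_k - u> by a constant over the sum of the steps; in the limit,
    <w, x> <= <w, u> for every weak limit point x of the averages and every w in
    (M + N + T) u, which makes x a zero. *)
Lemma tseng_penalty_ergodic : (exists u, op_add M N u (- T u)) ->
  exists2 u, op_add M N u (- T u) & weak_cvg (inner K) (weighted_mean lam z) u.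
Proof.
move=> [u0 Fu0]; apply: (@opial_passty _ _ [set u | op_add M N u (- T u)]) => //.
- by exists u0.
- by move=> u; exact: tseng_penalty_dist_cvg.
move=> U x UU ooU xP.
apply: (maximally_monotone_lipschitz_zero MNmax Tlip) => u _ [a Mua [c Nuc <-]].
have [e [e0 eS ineq]] := tseng_penalty_fejer Mua Nuc.
set w := a + c + T u in ineq *.
have [||S gS] := @telescope_bound _ (fun n => `|z n - u| ^+ 2)
    (fun n => 2 * (lam n * [< w, z n - u >])) e _ eS.
- by move=> n; exact: sqr_ge0.
- move=> n; have := ineq n; rewrite !ipE.
  have := mulr_ge0 (mulr_ge0 (lam0 n) gam0) (sqr_ge0 `|p n - u|).
  have := sqr_ge0 `|z n - p n|; lra.
suff : [< x, w >] <= [< u, w >] by rewrite dotDl dotNl; lra.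
have bd : [< u, w >] + S / 2 * (\sum_(0 <= k < n) lam k)^-1 @[n --> U] -->
    [< u, w >] + 0.
  apply: cvgD; first exact: cvg_cst.
  exact: cvg_trans (cvg_app _ ooU) (sum_stepsV_cvg0 (S / 2)).
rewrite -[leRHS]addr0; apply: (ler_cvg_to (xP w) bd).
apply: ooU; exists 1 => // -[//|n] _ /=.
rewrite ip_weighted_mean; have L0 := sum_steps_gt0 n.
rewrite mulrC ler_pdivrMr// mulrDl mulfVK ?gt_eqF//.
have := gS n.+1; rewrite -mulr_sumr.
under eq_bigr do rewrite dotDr dotNr mulrBr (ipC w) (ipC w).
rewrite sumrB -mulr_suml mulrC; lra.
Qed.

(** The inequality of tseng_penalty_fejer at a zero u makes
    lam n * |z_n - u|^2 summable. The limit D of |z_n - u|^2 is also that of its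
    weighted averages, which tend to 0. *)
Lemma tseng_penalty_strong u : 0 < gam -> op_add M N u (- T u) ->
  z @ \oo --> u.
Proof.
move=> gam_gt0 Fu; have /cvg_ex[D Dcvg] := tseng_penalty_dist_cvg Fu.
have [a Mua [c Nuc ac]] := Fu.
have [e [e0 eS ineq]] := tseng_penalty_fejer Mua Nuc.
(* For lam n <= 1, the two quadratic terms of the inequality dominate
   kap * lam n * |z_n - u|^2. *)
set kap := Num.min gam 4^-1.
have kap0 : 0 < kap by rewrite lt_min gam_gt0/=.
have kapg : kap <= gam by rewrite ge_min lexx.
have kap4 : kap <= 4^-1 by rewrite ge_min lexx orbT.
have [|e' [e'0 e'S ineq']] := @bounded_sums_dominate _
    (fun n => `|z n.+1 - u| ^+ 2 - `|z n - u| ^+ 2 + kap * (lam n * `|z n - u| ^+ 2)) e e0 eS.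
  near=> n.
  have lam1 : lam n <= 1.
    rewrite -(@expr_le1 _ 2)//; near: n.
    have /cvgrPdist_le/(_ _ ltr01) := step_sqr_cvg0.
    by apply: filterS => n; rewrite sub0r normrN ger0_norm ?sqr_ge0.
  apply: le_trans (ineq n); rewrite ac addNr ip0l.
  have split2 : `|z n - u| ^+ 2 <= 2 * `|z n - p n| ^+ 2 + 2 * `|p n - u| ^+ 2.
    have := ip_ge0 (z n - p n - (p n - u)); rewrite !norm_sqr !ipE.
    rewrite (ipC (p n) (z n)) (ipC u (z n)) (ipC u (p n)); lra.
  have k0 : 0 <= kap * lam n by rewrite mulr_ge0// ltW.
  have := ler_wpM2l k0 split2.
  have := ler_wpM2r (sqr_ge0 `|p n - u|) (ler_wpM2r (lam0 n) kapg).
  have : kap * lam n <= 4^-1 by have := ler_pM (ltW kap0) (lam0 n) kap4 lam1; rewrite mulr1.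
  move/(ler_wpM2r (sqr_ge0 `|z n - p n|)); lra.
have [|S gS] := @telescope_bound _ (fun n => `|z n - u| ^+ 2)
    (fun n => kap * (lam n * `|z n - u| ^+ 2)) e' _ e'S ineq'.
  by move=> n; exact: sqr_ge0.
have D0 : D <= 0.
  apply: (ler_cvg_to (weighted_cesaro lam_gt0 lam_l1 Dcvg) (sum_stepsV_cvg0 (S / kap))).
  exists 1 => // -[//|n] _ /=; have L0 := sum_steps_gt0 n.
  rewrite mulrC ler_pdivrMr// mulfVK ?gt_eqF// ler_pdivlMr// mulrC mulr_sumr.
  exact: gS.
have {}D0 : D = 0.
  apply/eqP; rewrite eq_le D0/=; apply: (ler_cvg_to (cvg_cst (0 : R)) Dcvg).
  by apply: nearW => n; exact: sqr_ge0.
rewrite D0 in Dcvg.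
apply/cvgrPdist_lt => eps eps0.
have eps2 : 0 < eps ^+ 2 by rewrite exprn_gt0.
have /cvgrPdist_lt/(_ _ eps2) := Dcvg.
apply: filterS => n; rewrite sub0r normrN ger0_norm ?sqr_ge0//.
by rewrite ltr_sqr ?nnegrE ?(ltW eps0)// distrC.
Unshelve. all: by end_near. Qed.

End TsengPenalty.

(** * Adjoints, nonnegative series and the Fitzpatrick condition *)

Lemma big_option (W : nmodType) (I : finType) (F : option I -> W) :
  \sum_o F o = F None + \sum_i F (Some i).
Proof.
rewrite (bigD1 None) //=; congr (_ + _).
rewrite (reindex_omap Some id) /=; last by case.
by apply: eq_bigl => i; rewrite eqxx.
Qed.

Section Adjoint.
Context {R : realType} {V W : hilbertType R} (L : {linear V -> W}).
Hypothesis Lcont : continuous L.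

Lemma continuous_linear_le : exists2 k, 0 < k & forall x, `|L x| <= k * `|x|.
Proof.
have /linear_boundedP [k [_ kP]] := @continuous_linear_bounded _ _ _ 0 L (@Lcont 0).
exists (`|k| + 1); first by rewrite ltr_wpDl.
by move=> x; apply: kP; have := ler_norm k; lra.
Qed.

(** The Riesz theorem provides a value, so the default is never taken. *)
Lemma adjointP x y : [< L x, y >] = [< x, adjoint L y >].
Proof.
rewrite /adjoint; case: xgetP => [z _|none]; first exact.
have [k k0 Lk] := continuous_linear_le.
have [|x'|z hz] := @riesz R V (fun x => [< L x, y >]) (k * `|y|).
- by move=> a u v; rewrite linearP !ipE.
- apply: le_trans (cauchy_schwarz _ _) _.
  by rewrite mulrAC ler_wpM2r.
by case: (none z).
Qed.

Lemma adjoint_lipschitz : exists k, forall y y',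
  `|adjoint L y - adjoint L y'| <= k * `|y - y'|.
Proof.
have [k k0 Lk] := continuous_linear_le; exists k => y y'.
set d := adjoint L y - adjoint L y'.
have [->|d0] := eqVneq d 0; first by rewrite normr0 mulr_ge0// ltW.
have : [< d, d >] <= k * `|d| * `|y - y'|.
  rewrite {2}/d dotDr dotNr -!adjointP -dotNr -dotDr.
  by rewrite (le_trans (ip_le_norm _ _))// ler_wpM2r.
by rewrite -norm_sqr expr2 mulrAC ler_pM2r// normr_gt0.
Qed.

End Adjoint.

Section Series.
Context {R : realType}.
Local Open Scope ereal_scope.

Lemma nneseries_bounded_sums (t : nat -> \bar R) :
  (forall n, (1 <= n)%N -> 0 <= t n) -> \sum_(1 <= n <oo) t n < +oo ->
  (forall n, t n.+1 \is a fin_num) /\ bounded_sums (fun n => fine (t n.+1)).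
Proof.
move=> t0 toy.
have ge n : \sum_(0 <= k < n) t k.+1 <= \sum_(1 <= n <oo) t n.
  by rewrite -(big_add1 _ _ 0 n.+1 xpredT t) nneseries_lim_ge// => k k1 _; exact: t0.
have fin n : t n.+1 \is a fin_num.
  rewrite ge0_fin_numE ?t0//; apply: le_lt_trans toy; apply: le_trans (ge n.+1).
  by rewrite big_nat_recr//= leeDr// sume_ge0// => k _; exact: t0.
split=> //; exists (fine (\sum_(1 <= n <oo) t n)) => n.
rewrite -lee_fin fineK; last first.
  by rewrite ge0_fin_numE ?nneseries_ge0// => k k1 _; exact: t0.
apply: le_trans (ge n); rewrite -sumEFin; apply: lee_sum => k _.
by rewrite fineK.
Qed.

Lemma nneseries_dvg (lam : nat -> R) : (forall n, (1 <= n)%N -> (0 < lam n)%R) ->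
  ~ (\sum_(1 <= n <oo) (`|lam n|)%:E < +oo) ->
  (\sum_(0 <= k < n) lam k.+1 @[n --> \oo] --> +oo)%R.
Proof.
move=> lam0 dvg; apply: nondecreasing_dvgn_lt.
  by move=> n k nk; apply: sum_nat_le_mono => // i; exact/ltW/lam0.
move=> /cvg_seq_bounded[M [_ hM]]; apply: dvg.
have M1 : (M < `|M| + 1)%R by have := ler_norm M; lra.
apply: (@le_lt_trans _ _ (`|M| + 1)%:E); last exact: ltry.
apply: lime_le; first by apply: is_cvg_nneseries.
apply: nearW => -[|n]; first by rewrite big_geq.
rewrite big_add1 /= sumEFin lee_fin.
have := hM _ M1 n I => /=; apply: le_trans.
apply: le_trans (ler_norm _); apply: ler_sum => k _.
by rewrite ger0_norm// ltW// lam0.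
Qed.

End Series.

Section Penalty.
Context {R : realType} {H : hilbertType R}.
Variables (B : H -> set H) (C : set H) (lambda beta : nat -> R).
Hypothesis CE : C = op_zer B.
Hypothesis lambda_gt0 : forall n, (1 <= n)%N -> 0 < lambda n.
Hypothesis beta_gt0 : forall n, (1 <= n)%N -> 0 < beta n.

Lemma support_fun_normal u (p : H) (b : R) : 0 < b -> normal_cone C u p ->
  support_fun C (b^-1 *: p) = ([< u, b^-1 *: p >])%:E.
Proof.
move=> b0 [Cu pu]; apply/eqP; rewrite eq_le; apply/andP; split.
  apply: ge_ereal_sup => _ [y Cy <-]; rewrite lee_fin (ipC u) !dotZl.
  rewrite ler_wpM2l ?invr_ge0 ?(ltW b0)//.
  by have := pu _ Cy; rewrite !ipE; lra.
by apply: ereal_sup_ubound; exists u => //; rewrite ipC.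
Qed.

(** At p / beta the support function of C is attained at u, and a graph point (y, b)
    of B bounds the Fitzpatrick function at (u, p / beta) from below: multiplied
    by lambda * beta this is the inequality. The graph point (u, 0) shows that
    the terms of the series are nonnegative, so its finiteness makes each of
    them finite and bounds their sums. *)
Lemma fitzpatrick_penalty u (p : H) : normal_cone C u p ->
  (\sum_(1 <= n <oo) (lambda n * beta n)%:E *
      (ereal_sup [set fitzpatrick B u' ((beta n)^-1 *: p) | u' in C]
       - support_fun C ((beta n)^-1 *: p)) < +oo)%E ->
  exists delta : nat -> R, [/\ forall n, 0 <= delta n, bounded_sums delta &
    forall n y b, B y b -> lambda n.+1 * beta n.+1 * [< b, u - y >] <=
      delta n + lambda n.+1 * [< p, u - y >]].
Proof.
move=> pu; have [Cu _] := pu.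
pose t n := ((lambda n * beta n)%:E *
  (ereal_sup [set fitzpatrick B u' ((beta n)^-1 *: p) | u' in C]
   - support_fun C ((beta n)^-1 *: p)))%E.
rewrite -[X in (X < _)%E]/(\sum_(1 <= n <oo) t n)%E => tfin.
have tge n y b : B y b -> ((lambda n.+1 * beta n.+1 * [< b, u - y >] -
    lambda n.+1 * [< p, u - y >])%:E <= t n.+1)%E.
  move=> Byb; have b0 := beta_gt0 (ltn0Sn n); have l0 := lambda_gt0 (ltn0Sn n).
  rewrite /t (support_fun_normal b0 pu).
  have -> : lambda n.+1 * beta n.+1 * [< b, u - y >] - lambda n.+1 * [< p, u - y >] =
     lambda n.+1 * beta n.+1 * ([< u, b >] + [< y, (beta n.+1)^-1 *: p >] - [< y, b >]
       - [< u, (beta n.+1)^-1 *: p >]).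
    rewrite !ipE (ipC b u) (ipC b y) (ipC p u) (ipC p y); field.
    by rewrite gt_eqF.
  rewrite EFinM lee_pmul2l ?lte_fin ?mulr_gt0// EFinB leeD2r//.
  apply: (@le_trans _ _ (fitzpatrick B u ((beta n.+1)^-1 *: p))).
    by apply: ereal_sup_ubound; exists (y, b).
  by apply: ereal_sup_ubound; exists u.
have Bu0 : B u 0 by move: Cu; rewrite CE.
have t0 n : (1 <= n)%N -> (0 <= t n)%E.
  by case: n => // n _; have := tge n _ _ Bu0; rewrite subrr !ip0r !mulr0 subrr.
have [fin bnd] := nneseries_bounded_sums t0 tfin.
exists (fun n => fine (t n.+1)); split=> //.
  by move=> n; rewrite fine_ge0// t0.
move=> n y b Byb; have := tge n _ _ Byb.
by rewrite -[X in (_ <= X)%E]fineK ?fin// lee_fin; lra.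
Qed.

End Penalty.

(** * The primal-dual inclusion *)

Lemma hprod_sumE (R : realType) (I : finType) (G : I -> hilbertType R)
  (J : Type) (r : seq J) (F : J -> hprod_hilbert G) i :
  (\sum_(j <- r) F j) i = \sum_(j <- r) F j i.
Proof. by elim/big_rec2: _ => // j a b _ <-. Qed.

Lemma hprod_cvg (R : realType) (I : finType) (G : I -> hilbertType R)
  (z : nat -> hprod_hilbert G) (l : hprod_hilbert G) i :
  z @ \oo --> l -> z n i @[n --> \oo] --> l i.
Proof.
move=> /cvgrPdist_lt zl; apply/cvgrPdist_lt => e /zl; apply: filterS => n.
apply: le_lt_trans; exact: (hprod_proj_le (l - z n) i).
Qed.

Unset Implicit Arguments.

Section PrimalDual.
Context {R : realType} {H : hilbertType R} {m : nat} {G : 'I_m -> hilbertType R}.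

(** The index None is that of the primal variable. *)
Definition pd_family (o : option 'I_m) : hilbertType R :=
  if o is Some i then G i else H.

Definition pd_space : hilbertType R := hprod_hilbert pd_family.

Definition pd_pair (x : H) (v : forall i, G i) : pd_space :=
  fun o => match o return pd_family o with Some i => v i | None => x end.

Definition pd_op (M0 : H -> set H) (Mi : forall i, G i -> set (G i)) :
    pd_space -> set pd_space :=
  op_prod (fun o => match o return pd_family o -> set (pd_family o) with
                    | Some i => Mi i | None => M0 end).

Lemma pd_pairE (w : pd_space) : w = pd_pair (w None) (fun i => w (Some i)).
Proof. by apply: functional_extensionality_dep => -[]. Qed.

Lemma pd_ipE (a b : pd_space) : [< a, b >] =
  [< (a None : H), b None >] + \sum_i [< (a (Some i) : G i), b (Some i) >].
Proof. exact: big_option. Qed.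

Lemma maximally_monotone_pd M0 Mi : maximally_monotone M0 ->
  (forall i, maximally_monotone (Mi i)) -> maximally_monotone (pd_op M0 Mi).
Proof. by move=> h0 hi; apply: maximally_monotone_prod => -[]. Qed.

Variables (A : H -> set H) (D : H -> H) (C : set H).
Variables (Ai Di : forall i, G i -> set (G i)) (Dinv : forall i, G i -> G i).
Variables (L : forall i, {linear H -> G i}) (eta : R) (nu : 'I_m -> R).
Hypothesis hDmono : op_monotone (op_fun D).
Hypothesis hDlip : eta.-lipschitz D.
Hypothesis hDi : forall i, maximally_monotone (Di i).
Hypothesis hDinv : forall i, op_inv (Di i) = op_fun (Dinv i).
Hypothesis hDinvlip : forall i, (nu i).-lipschitz (Dinv i).
Hypothesis hLcont : forall i, continuous (L i).

Definition pd_maximal : pd_space -> set pd_space :=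
  pd_op A (fun i => op_inv (Ai i)).

Definition pd_normal : pd_space -> set pd_space :=
  pd_op (normal_cone C) (fun i _ => [set 0]).

(** The single-valued part of the primal-dual inclusion, on which the algorithm
    makes its explicit steps. *)
Definition pd_forward (w : pd_space) : pd_space :=
  pd_pair (\sum_i adjoint (L i) (w (Some i)) + D (w None))
          (fun i => Dinv i (w (Some i)) - L i (w None)).

Lemma Dinv_monotone (i : 'I_m) (a b : G i) : 0 <= [< a - b, Dinv i a - Dinv i b >].
Proof.
have /maximally_monotoneP[mono _] := maximally_monotone_inv (hDi i).
by apply: mono; rewrite hDinv.
Qed.

(** The contributions of L i to the two coordinates cancel by adjunction. *)
Lemma pd_forward_monotone (a b : pd_space) :
  0 <= [< a - b, pd_forward a - pd_forward b >].
Proof.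
rewrite pd_ipE.
set x := a None; set y := b None.
pose v i : G i := a (Some i); pose w i : G i := b (Some i).
have -> : [< ((a - b) None : H), (pd_forward a - pd_forward b) None >] =
   \sum_i [< L i (x - y), v i - w i >] + [< x - y, D x - D y >].
  have -> : (pd_forward a - pd_forward b) None =
     (\sum_i adjoint (L i) (v i) - \sum_i adjoint (L i) (w i)) + (D x - D y).
    by rewrite addrACA -opprD.
  rewrite dotDr; congr (_ + _); rewrite -sumrB ipC ip_suml.
  by apply: eq_bigr => i _; rewrite ipC dotDr dotNr -!adjointP// -dotNr -dotDr.
rewrite addrAC -big_split /= addr_ge0//; last exact: hDmono.
apply: sumr_ge0 => i _.
have -> : [< (a - b) (Some i), (pd_forward a - pd_forward b) (Some i) >] =
    [< v i - w i, (Dinv i (v i) - Dinv i (w i)) - L i (x - y) >].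
  congr (inner _ _ _).
  have -> : (pd_forward a - pd_forward b) (Some i) =
    (Dinv i (v i) - L i x) - (Dinv i (w i) - L i y) by [].
  by rewrite (linearB (L i)) !opprD addrACA.
have := Dinv_monotone i (v i) (w i); have := ipC (L i (x - y)) (v i - w i).
rewrite dotDr dotNr; lra.
Qed.

Lemma pd_forward_lipschitz : exists l, forall a b,
  `|pd_forward a - pd_forward b| <= l * `|a - b|.
Proof.
have [kL kLP] : exists k : 'I_m -> R, forall i x, `|L i x| <= k i * `|x|.
  have h i : exists k, forall x, `|L i x| <= k * `|x|.
    by have [k _ kP] := continuous_linear_le (hLcont i); exists k.
  by exists (fun i => projT1 (cid (h i))) => i; exact: (projT2 (cid (h i))).
have [ka kaP] : exists k : 'I_m -> R, forall i v w,
    `|adjoint (L i) v - adjoint (L i) w| <= k i * `|v - w|.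
  have h i := adjoint_lipschitz (hLcont i).
  by exists (fun i => projT1 (cid (h i))) => i; exact: (projT2 (cid (h i))).
exists (\sum_i `|ka i| + `|eta| + \sum_i (`|nu i| + `|kL i|)) => a b.
have proj o : `|a o - b o| <= `|a - b| by exact: (hprod_proj_le (a - b) o).
have scale_proj (r : R) o : r * `|a o - b o| <= `|r| * `|a - b|.
  by apply: le_trans (ler_wpM2r _ (ler_norm r)) _ => //; rewrite ler_wpM2l.
apply: le_trans (hprod_norm_le_sum _) _; rewrite big_option mulrDl lerD//.
  have -> : (pd_forward a - pd_forward b) None =
     (\sum_i (adjoint (L i) (a (Some i)) - adjoint (L i) (b (Some i))))
      + (D (a None) - D (b None)).
    by rewrite sumrB addrACA -opprD.
  apply: le_trans (ler_normD _ _) _; rewrite mulrDl lerD//.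
    rewrite mulr_suml; apply: le_trans (ler_norm_sum _ _ _) _.
    by apply: ler_sum => i _; apply: le_trans (kaP _ _ _) (scale_proj _ (Some i)).
  by apply: le_trans (hDlip (a None, b None) _) (scale_proj _ None).
rewrite mulr_suml; apply: ler_sum => i _.
have -> : (pd_forward a - pd_forward b) (Some i) =
    (Dinv i (a (Some i)) - Dinv i (b (Some i))) - L i (a None - b None).
  have -> : (pd_forward a - pd_forward b) (Some i) =
    (Dinv i (a (Some i)) - L i (a None)) - (Dinv i (b (Some i)) - L i (b None)) by [].
  by rewrite (linearB (L i)) !opprD addrACA.
apply: le_trans (ler_normB _ _) _; rewrite mulrDl lerD//.
  by apply: le_trans (hDinvlip i (a (Some i), b (Some i)) _) (scale_proj _ (Some i)).
by apply: le_trans (kLP _ _) (scale_proj _ None).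
Qed.

(** The normal cone acts on the primal coordinate only, so the maximality of this
    sum is inherited from that of A + N_C. *)
Lemma pd_op_addE : op_add pd_maximal pd_normal =
  pd_op (op_add A (normal_cone C)) (fun i => op_inv (Ai i)).
Proof.
apply/funext => w; apply/seteqP; split=> u.
  move=> [a Ma [c Nc <-]] -[i|]; last by exists (a None); [exact: (Ma None)|
    exists (c None); [exact: (Nc None)|]].
  have ci : c (Some i) = 0 := Nc (Some i).
  have -> : (a + c) (Some i) = a (Some i) by rewrite -[RHS]addr0 -ci.
  exact: (Ma (Some i)).
move=> h; have [a0 Aa0 [c0 Nc0 ac]] := h None.
exists (pd_pair a0 (fun i => u (Some i))).
  by case=> [i|//]; exact: (h (Some i)).
exists (pd_pair c0 (fun i => 0)); first by case.
by apply: functional_extensionality_dep => -[i|//]; exact: addr0.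
Qed.

Definition primal_dual_solution (x : H) (v : forall i, G i) : Prop :=
  (exists a c, [/\ A x a, normal_cone C x c &
     a + c + (\sum_i adjoint (L i) (v i) + D x) = 0]) /\
  forall i, par_sum (Ai i) (Di i) (L i x) (v i).

(** As D_i^-1 is single-valued, the parallel sum is seen from its inverse. *)
Lemma par_sumE (i : 'I_m) (y w : G i) :
  par_sum (Ai i) (Di i) y w <-> Ai i (y - Dinv i w) w.
Proof.
have DE (d : G i) : op_inv (Di i) w d <-> d = Dinv i w by rewrite hDinv.
split=> [[a Aa [d /DE -> <-]]|Aw]; first by rewrite addrK.
by exists (y - Dinv i w) => //; exists (Dinv i w); [exact/DE|rewrite subrK].
Qed.

Lemma pd_zeroP (x : H) (v : forall i, G i) :
  op_add pd_maximal pd_normal (pd_pair x v) (- pd_forward (pd_pair x v)) <->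
  primal_dual_solution x v.
Proof.
split.
  move=> [a Ma [c Nc ac]].
  have aco o : a o + c o = - pd_forward (pd_pair x v) o.
    by rewrite -[RHS]/((- pd_forward (pd_pair x v)) o) -ac.
  split.
    exists (a None), (c None); split; [exact: (Ma None)|exact: (Nc None)|].
    by rewrite (aco None) addNr.
  move=> i; apply/par_sumE; have ci : c (Some i) = 0 := Nc (Some i).
  have := aco (Some i); rewrite ci addr0 /= opprB => <-.
  exact: (Ma (Some i)).
move=> [[a [c [Aa Nc ac]]] hv].
exists (pd_pair a (fun i => L i x - Dinv i (v i))).
  by case=> [i|//]; apply/par_sumE; exact: hv.
exists (pd_pair c (fun i => 0)); first by case.
apply: functional_extensionality_dep => -[i|].
  by rewrite [LHS]addr0 -[RHS]/(- (Dinv i (v i) - L i x)) opprB.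
by apply/eqP; rewrite -[eqbRHS]/(- (\sum_i adjoint (L i) (v i) + D x)) -addr_eq0;
  apply/eqP.
Qed.

Lemma primal_solutionP (x : H) :
  primal_solution A D C Ai Di L x <-> exists v, primal_dual_solution x v.
Proof.
split.
  move=> [_ [_ [a Aa [_ [v hv <-] <-]] [_ -> <-]] [c Nc e]].
  exists v; split=> //; exists a, c; split=> //.
  by rewrite -[RHS]e addrAC addrA.
move=> [v [[a [c [Aa Nc e]]] hv]].
exists (a + \sum_i adjoint (L i) (v i) + D x).
  exists (a + \sum_i adjoint (L i) (v i)); last by exists (D x).
  by exists a => //; exists (\sum_i adjoint (L i) (v i)) => //; exists v.
by exists c => //; rewrite -[RHS]e [RHS]addrAC addrA.
Qed.

Lemma dual_solutionP (v : forall i, G i) :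
  dual_solution A D C Ai Di L v <-> exists x, primal_dual_solution x v.
Proof.
split.
  move=> [x [hv [_ [_ [a Aa [_ -> <-]] [_ -> <-]] [c Nc e]]]].
  exists x; split=> //; exists a, c; split=> //.
  by rewrite -[RHS]e addrAC addrA.
move=> [x [[a [c [Aa Nc e]]] hv]]; exists x; split=> //.
exists (a + \sum_i adjoint (L i) (v i) + D x).
  exists (a + \sum_i adjoint (L i) (v i)); last by exists (D x).
  by exists a => //; exists (\sum_i adjoint (L i) (v i)).
by exists c => //; rewrite -[RHS]e [RHS]addrAC addrA.
Qed.

End PrimalDual.

Arguments pd_space {R} H {m} G.

(** * The algorithm *)

Lemma ergodic_meanE (R : realType) (V : hilbertType R) (lambda : nat -> R)
  (x : nat -> V) n : ergodic_mean lambda x n =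
  weighted_mean (fun k => lambda k.+1) (fun k => x k.+1) n.
Proof. by rewrite /ergodic_mean /weighted_mean !big_add1. Qed.

Lemma weighted_mean_proj (R : realType) (I : finType) (G : I -> hilbertType R)
  (lam : nat -> R) (z : nat -> hprod_hilbert G) n i :
  weighted_mean lam z n i = weighted_mean lam (fun k => z k i) n.
Proof.
rewrite /weighted_mean -[LHS]/(_ *: ((\sum_(0 <= k < n) lam k *: z k) i)).
by rewrite hprod_sumE.
Qed.

Theorem theorem5 (R : realType) (H : hilbertType R)
  (A : H -> set H) (hA : maximally_monotone A)
  (D : H -> H) (hDmono : op_monotone (op_fun D))
  (eta : R) (heta : 0 < eta) (hDlip : (eta^-1).-lipschitz D)
  (m : nat) (hm : (1 <= m)%N) (G : 'I_m -> hilbertType R)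
  (Ai : forall i, G i -> set (G i)) (hAi : forall i, maximally_monotone (Ai i))
  (Di : forall i, G i -> set (G i)) (hDi : forall i, maximally_monotone (Di i))
  (Dinv : forall i, G i -> G i) (hDinv : forall i, op_inv (Di i) = op_fun (Dinv i))
  (nu : 'I_m -> R) (hnu : forall i, 0 < nu i)
  (hDinvlip : forall i, ((nu i)^-1).-lipschitz (Dinv i))
  (L : forall i, {linear H -> G i}) (hLcont : forall i, continuous (L i))
  (hLnz : forall i, exists x, L i x != 0)
  (B : H -> set H) (hB : maximally_monotone B)
  (C : set H) (hC : C = op_zer B) (hC0 : C !=set0)
  (lambda beta : nat -> R)
  (hlambda : forall n, (1 <= n)%N -> 0 < lambda n)
  (hbeta : forall n, (1 <= n)%N -> 0 < beta n)
  (* (i) *)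
  (hAN : maximally_monotone (op_add A (normal_cone C)))
  (hzer : op_zer (primal_op A D C Ai Di L) !=set0)
  (* (ii) *)
  (hfitz : forall p, op_ran (normal_cone C) p ->
    (\sum_(1 <= n <oo) (lambda n * beta n)%:E *
        (ereal_sup [set fitzpatrick B u ((beta n)^-1 *: p) | u in C]
         - support_fun C ((beta n)^-1 *: p)) < +oo)%E)
  (* (iii) *)
  (hl2 : (\sum_(1 <= n <oo) (`|lambda n| ^+ 2)%:E < +oo)%E)
  (hl1 : ~ (\sum_(1 <= n <oo) (`|lambda n|)%:E < +oo)%E)
  (x y1 p1 q : nat -> H) (v y2 p2 : nat -> forall i, G i)
  (hy1 : forall n, (1 <= n)%N ->
    y1 n = x n - lambda n *: (\sum_(i < m) adjoint (L i) (v n i) + D (x n)))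
  (hy2 : forall n i, (1 <= n)%N ->
    y2 n i = v n i - lambda n *: (Dinv i (v n i) - L i (x n)))
  (hp1 : forall n, (1 <= n)%N -> p1 n = resolvent (op_scale (lambda n) A) (y1 n))
  (hp2 : forall n i, (1 <= n)%N ->
    p2 n i = resolvent (op_scale (lambda n) (op_inv (Ai i))) (y2 n i))
  (hq : forall n, (1 <= n)%N ->
    q n = p1 n - lambda n *: (\sum_(i < m) adjoint (L i) (p2 n i) + D (p1 n)))
  (hv : forall n i, (1 <= n)%N ->
    v n.+1 i = v n i - y2 n i + p2 n i
               - lambda n *: (Dinv i (p2 n i) - L i (p1 n)))
  (hx : forall n, (1 <= n)%N ->
    x n.+1 = resolvent (op_scale (lambda n * beta n) B) (x n - y1 n + q n)) :
  (exists xbar : H, primal_solution A D C Ai Di L xbar /\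
     weak_cvg (inner H) (ergodic_mean lambda x) xbar) /\
  (exists vbar : forall i, G i, dual_solution A D C Ai Di L vbar /\
     weak_cvg prod_inner
       (fun n i => ergodic_mean lambda (fun k => v k i) n) vbar) /\
  (strongly_monotone A -> (forall i, strongly_monotone (op_inv (Ai i))) ->
   (exists xbar : H, primal_solution A D C Ai Di L xbar /\
      (forall x', primal_solution A D C Ai Di L x' -> x' = xbar) /\
      x @ \oo --> xbar) /\
   (exists vbar : forall i, G i, dual_solution A D C Ai Di L vbar /\
      (forall v', dual_solution A D C Ai Di L v' -> v' = vbar) /\
      (fun n => prod_norm (fun i => v n i - vbar i)) @ \oo --> (0 : R))).
Proof.
(* The sequences of the algorithm start at index 1, those of the method at 0. *)
pose lam n := lambda n.+1.
pose z n : pd_space H G := pd_pair (x n.+1) (v n.+1).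
pose p n : pd_space H G := pd_pair (p1 n.+1) (p2 n.+1).
pose T := pd_forward D Dinv L.
pose M := pd_maximal A Ai.
pose N : pd_space H G -> set (pd_space H G) := pd_normal C.
have lam_gt0 n : 0 < lam n by exact: hlambda.
have lam_l2 : bounded_sums (fun n => lam n ^+ 2).
  have [|_] := nneseries_bounded_sums _ hl2.
    by move=> n _; rewrite lee_fin sqr_ge0.
  congr bounded_sums; apply/funext => n /=.
  by rewrite real_normK ?num_real.
have lam_l1 := nneseries_dvg hlambda hl1.
have MN : op_add M N = pd_op (op_add A (normal_cone C)) (fun i => op_inv (Ai i)).
  exact: pd_op_addE.
have MNmax : maximally_monotone (op_add M N).
  rewrite MN; apply: maximally_monotone_pd => // i.
  exact: maximally_monotone_inv.
have Tmono : forall a b, 0 <= [< a - b, T a - T b >].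
  exact: (pd_forward_monotone D Di Dinv L hDmono hDi hDinv hLcont).
have [l Tlip] := pd_forward_lipschitz D Dinv L (eta^-1) (fun i => (nu i)^-1)
  hDlip hDinvlip hLcont.
have forward n : M (p n) ((lam n)^-1 *: (z n - lam n *: T (z n) - p n)).
  case=> [i|].
    have := resolventP (y2 n.+1 i) (lam_gt0 n) (maximally_monotone_inv (hAi i)).
    by rewrite -hp2// hy2.
  by have := resolventP (y1 n.+1) (lam_gt0 n) hA; rewrite -hp1// hy1.
have backward u c : N u c -> exists delta : nat -> R,
    [/\ forall n, 0 <= delta n, bounded_sums delta & forall n,
      [< p n + lam n *: (T (z n) - T (p n)) - z n.+1, u - z n.+1 >] <=
        delta n + lam n * [< c, u - z n.+1 >]].
  move=> Nuc; have Nuc0 : normal_cone C (u None) (c None) := Nuc None.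
  have hc : op_ran (normal_cone C) (c None) by exists (u None).
  have [delta [delta0 deltaS h]] :=
    fitzpatrick_penalty hC hlambda hbeta Nuc0 (hfitz _ hc).
  exists delta; split=> // n.
  pose s : H := p1 n.+1 + lam n *: (T (z n) None - T (p n) None).
  (* The argument of the resolvent of B is Tseng's corrected point. *)
  have sE : x n.+1 - y1 n.+1 + q n.+1 = s.
    by rewrite hy1// hq// opprB subrKC addrCA -scalerBr.
  have Bx := @resolventP _ _ B _ s (mulr_gt0 (lam_gt0 n) (hbeta n.+1 isT)) hB.
  rewrite -sE -hx// sE in Bx.
  rewrite !pd_ipE !big1 ?addr0.
  - have := h n _ _ Bx; rewrite dotZl mulrA divff ?mul1r//.
    by rewrite gt_eqF ?mulr_gt0 ?hlambda ?hbeta.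
  - by move=> i _; rewrite (Nuc (Some i)) ip0l.
  (* In the dual coordinates z n.+1 is Tseng's corrected point itself. *)
  move=> i _; rewrite [X in [< X, _ >]](_ : _ = 0) ?ip0l//.
  have -> : (p n + lam n *: (T (z n) - T (p n)) - z n.+1) (Some i) =
    p2 n.+1 i + lam n *: ((Dinv i (v n.+1 i) - L i (x n.+1))
      - (Dinv i (p2 n.+1 i) - L i (p1 n.+1))) - v n.+2 i by [].
  rewrite (hv n.+1 i isT) (hy2 n.+1 i isT) subKr scalerBr addrA.
  by rewrite [p2 n.+1 i + _]addrC subrr.
have zero_kkt u : op_add M N u (- T u) ->
    primal_dual_solution A D C Ai Di L (u None) (fun i => u (Some i)).
  by rewrite {1 2}(pd_pairE u) => /(pd_zeroP A D C Ai Di Dinv L hDinv).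
have kkt_zero a b : primal_dual_solution A D C Ai Di L a b ->
    op_add M N (pd_pair a b) (- T (pd_pair a b)).
  by move/(pd_zeroP A D C Ai Di Dinv L hDinv).
have [x0 /(primal_solutionP A D C Ai Di L) [v0 kkt0]] := hzer.
have zero_ex : exists u, op_add M N u (- T u).
  by exists (pd_pair x0 v0); exact: kkt_zero.
have Mmono : op_monotone M.
  by have [] := @maximally_monotone_pd _ _ _ _ A (fun i => op_inv (Ai i)) hA
    (fun i => maximally_monotone_inv (hAi i)).
have Mmono0 x' a y b : M x' a -> M y b -> 0 * `|x' - y| ^+ 2 <= [< x' - y, a - b >].
  by rewrite mul0r; exact: Mmono.
have [u Fu zu] := tseng_penalty_ergodic (lexx 0) Mmono0 MNmax Tmono Tlip lam_gt0
  lam_l2 lam_l1 forward backward zero_ex.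
split; [|split].
- exists (u None); split.
    by apply/(primal_solutionP A D C Ai Di L); exists (fun i => u (Some i)); exact: zero_kkt.
  move=> w; have := zu (pd_pair w (fun=> 0)).
  rewrite pd_ipE /= big1 ?addr0; last by move=> i _; rewrite ip0r.
  apply: cvg_trans; apply: near_eq_cvg; apply: nearW => n.
  rewrite pd_ipE big1 ?addr0; last by move=> i _; rewrite ip0r.
  by rewrite weighted_mean_proj ergodic_meanE.
- exists (fun i => u (Some i)); split.
    by apply/(dual_solutionP A D C Ai Di L); exists (u None); exact: zero_kkt.
  move=> w; have := zu (pd_pair 0 w).
  rewrite pd_ipE /= ip0r add0r.
  apply: cvg_trans; apply: near_eq_cvg; apply: nearW => n.
  rewrite pd_ipE /= ip0r add0r; apply: eq_bigr => i _.
  by rewrite weighted_mean_proj ergodic_meanE.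
move=> As Ais.
have [gam gam0 Mgam] : exists2 gam : R, 0 < gam & forall x' a y b, M x' a -> M y b ->
    gam * `|x' - y| ^+ 2 <= [< x' - y, a - b >].
  by apply: strongly_monotone_prod => -[].
have strong a b : primal_dual_solution A D C Ai Di L a b ->
    z @ \oo --> pd_pair a b.
  move=> /kkt_zero; apply: (tseng_penalty_strong (ltW gam0) Mgam Tmono Tlip lam_gt0
    lam_l2 lam_l1 forward backward) => //.
have uniq a b : primal_dual_solution A D C Ai Di L a b ->
    pd_pair a b = pd_pair x0 v0.
  by move=> /strong h; exact: (cvg_unique _ h (strong _ _ kkt0)).
split.
- exists x0; split; [|split].
  + by apply/(primal_solutionP A D C Ai Di L); exists v0.
  + move=> x' /(primal_solutionP A D C Ai Di L) [v' /uniq e].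
    by have := congr1 (fun w : pd_space H G => w None) e.
  + by rewrite -(cvg_shiftS x); exact: (@hprod_cvg _ _ _ z _ None (strong _ _ kkt0)).
exists v0; split; [|split].
- by apply/(dual_solutionP A D C Ai Di L); exists x0.
- move=> v' /(dual_solutionP A D C Ai Di L) [x' /uniq e].
  apply: functional_extensionality_dep => i.
  by have := congr1 (fun w : pd_space H G => w (Some i)) e.
rewrite -cvg_shiftS /=; have /cvgrPdist_lt h := strong _ _ kkt0.
apply/cvgrPdist_lt => e /h; apply: filterS => n.
rewrite sub0r normrN => /(le_lt_trans _); apply.
rewrite distrC ger0_norm ?sqrtr_ge0// -ler_sqr ?nnegrE ?sqrtr_ge0//.
rewrite sqr_sqrtr; last by apply: sumr_ge0 => i _; exact: ip_ge0.
by rewrite [leRHS]norm_sqr pd_ipE lerDr ip_ge0.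
Qed.
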